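(* Let $P\subset\mathbb{R}^d$ be a $d$-dimensional smooth Fano polytope and let $n:=|\partial P\cap\mathbb{Z}^d|$. Then $$(d-1)n-(d+1)(d-2)\ \le\ d!\,\mathrm{vol}(P)\ \le\ \binom{n-\lfloor (d+1)/2\rfloor}{n-d}+\binom{n-\lfloor (d+2)/2\rfloor}{n-d}.$$
   Context: A convex lattice polytope in $\mathbb{R}^d$ is the convex hull of finitely many points of $\mathbb{Z}^d$. A $d$-dimensional convex lattice polytope $P\subset\mathbb{R}^d$ with the origin in its strict interior is called smooth Fano if the vertices of each facet of $P$ form a $\mathbb{Z}$-basis of $\mathbb{Z}^d$. $\partial P$ denotes the boundary of $P$, and $\mathrm{vol}(P)$ is the ordinary Euclidean $d$-dimensional volume. *)

(* Defs.v *)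
From HB Require Import structures.
From mathcomp Require Import all_boot all_order all_algebra.
From mathcomp Require Import finmap.
From mathcomp Require Import all_classical all_reals all_analysis.

Set Implicit Arguments.
Unset Strict Implicit.
Unset Printing Implicit Defensive.

Import Order.TTheory GRing.Theory Num.Theory.
Import numFieldNormedType.Exports.

Local Open Scope classical_set_scope.
Local Open Scope ring_scope.

(* Lebesgue measure on R^d: the d-fold product of the one-dimensional Lebesgue
   measure, built on the nested product R * (R * ( ... * unit)), then
   transported to row vectors along [prodR_rV]. *)

Fixpoint prodR_display (R : realType) (d : nat) : measure_display :=
  match d with
  | 0 => default_measure_display
  | d'.+1 =>
      ((R.-ocitv.-measurable).-sigma, prodR_display R d').-prod%mdisp
  end.

Fixpoint prodR (R : realType) (d : nat) : measurableType (prodR_display R d) :=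
  match d return measurableType (prodR_display R d) with
  | 0 => unit
  | d'.+1 => (measurableTypeR R * prodR R d')%type
  end.

Fixpoint prodR_lebesgue (R : realType) (d : nat) : set (prodR R d) -> \bar R :=
  match d return set (prodR R d) -> \bar R with
  | 0 => dirac tt
  | d'.+1 => (@lebesgue_measure R \x @prodR_lebesgue R d')%E
  end.

Fixpoint prodR_rV (R : realType) (d : nat) : prodR R d -> 'rV[R]_d :=
  match d return prodR R d -> 'rV[R]_d with
  | 0 => fun=> 0
  | d'.+1 => fun p => row_mx (const_mx p.1 : 'rV_1) (prodR_rV p.2)
  end.

Definition vol (R : realType) (d : nat) (A : set 'rV[R]_d) : \bar R :=
  @prodR_lebesgue R d (@prodR_rV R d @^-1` A).

Definition lattice (R : realType) (d : nat) : set 'rV[R]_d :=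
  [set x | x \is a mxOver Num.int].

Definition conv_hull (R : realType) (d : nat) (S : set 'rV[R]_d) :
    set 'rV[R]_d :=
  smallest (@convex_set R 'rV[R]_d) S.

Definition lattice_polytope (R : realType) (d : nat) (P : set 'rV[R]_d) :=
  exists S : set 'rV[R]_d,
    [/\ finite_set S, S `<=` @lattice R d & P = conv_hull S].

Definition boundary (T : topologicalType) (A : set T) : set T :=
  closure A `\` interior A.

(* The affine hull of [A] has dimension [k]: its direction [U] is the least
   linear subspace containing all the differences [x - x0], [x] in [A].
   The empty set has no dimension. *)
Definition has_dim (R : realType) (d : nat) (A : set 'rV[R]_d) (k : nat) :=
  exists (x0 : 'rV[R]_d) (U : {vspace 'rV[R]_d}),
    [/\ A x0,
        forall x, A x -> x - x0 \in U,
        forall W : {vspace 'rV[R]_d},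
          (forall x, A x -> x - x0 \in W) -> (U <= W)%VS
      & \dim U = k].

(* Faces are the subsets cut out by valid linear inequalities; [P] itself
   (a = 0, c = 0) and the empty set (a = 0, c = 1) are included. *)
Definition face (R : realType) (d : nat) (P F : set 'rV[R]_d) :=
  exists (a : 'rV[R]_d) (c : R),
    (forall x, P x -> \sum_i a 0 i * x 0 i <= c) /\
    F = P `&` [set x | \sum_i a 0 i * x 0 i = c].

Definition facet (R : realType) (d : nat) (P F : set 'rV[R]_d) :=
  face P F /\ has_dim F d.-1.

Definition vertices (R : realType) (d : nat) (P : set 'rV[R]_d) :
    set 'rV[R]_d :=
  [set v | face P [set v]].

Definition Z_basis (R : realType) (d : nat) (V : set 'rV[R]_d) :=
  exists b : 'I_d -> 'rV[R]_d,
    [/\ V = range b,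
        forall i, lattice (b i)
      & forall x, lattice x ->
          exists! c : {ffun 'I_d -> int}, x = \sum_i b i *~ c i].

(* Full-dimensionality of [P] is implied by [0] being an interior point. *)
Definition smooth_Fano (R : realType) (d : nat) (P : set 'rV[R]_d) :=
  [/\ lattice_polytope P,
      interior P 0
    & forall F, facet P F -> Z_basis (vertices F)].

(* Main.v *)
Require Import Defs.
From HB Require Import structures.
From mathcomp Require Import all_boot all_order all_algebra.
From mathcomp Require Import ring lra zify.

(** Let [F] be the set of facets of [P]. The theorem follows from three facts:
    the lattice points of the boundary are exactly the vertices of [P], so that
    [n] counts vertices; [d! vol P] is the number of facets; and the number of
    facets of a simplicial [d]-polytope with [n] vertices is bounded above by
    McMullen's theorem and below by Barnette's.

    The first fact holds because a facet is spanned by a basis of the lattice: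
    a lattice point in the cone over a facet has natural numbers as coordinates,
    and it lies on the boundary when they add up to [1]
    ([facet_body_boundary]).

    The second fact is Ehrhart's counting argument ([vol_facet_body]). In the
    cone over a facet, the lattice points of the dilate [k P] correspond to the
    [d]-tuples of natural numbers with sum at most [k], and there are
    ['C(d + k, d)] of these. For a constant [D], the unit cubes placed
    at the lattice points of [(N + D) P] cover [N P], while those placed at the
    lattice points of [(N - D) P] inside the open cones are disjoint and stay in
    [N P]. Rescaled by [1 / N], both families have a total volume that tends to
    [#|F| / d!]. Only the volume of a cube is used: there is no change of
    variables, and no common boundary of simplices to discard.

    The two bounds on [#|F|] are proved by linear programming on the polar
    polytope, which has one vertex [normal s] for each facet [s], and whose
    edges leave [normal s] in the directions opposite to the basis dual to the
    vertices of [s] ([facet_system]). An objective [c] increases along such an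
    edge exactly when the corresponding coordinate of [c] in the basis [s] is
    negative, and a vertex without increasing edges is a maximum
    ([height_le_top]); the same holds inside each face.

    Upper bound: for a generic [c], let [h_k] be the number of facets in which
    [c] has [k] negative coordinates. Every face has a unique top facet, so the
    numbers of faces determine the [h_k], which therefore do not depend on [c]
    ([hnum_indep]); replacing [c] by [- c] gives the Dehn-Sommerville equations
    ([hnumN]). Summing over the links of the vertices gives McMullen's recursion
    [(k + 1) h_(k+1) + (d - k) h_k <= n h_k] ([hnum_le_bin]), because the link
    of [v] has [h]-numbers at most those of the whole, as an objective close to
    [v] shows ([hnum_link_le]).

    Lower bound, after Barnette: fix a facet [r] and remove the other vertices
    one at a time, so that the remaining set [S] stays connected in the graph
    of [P] and the removed vertex [v] lies in a facet that meets [S] only in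
    [v] ([exists_removable]). The facets around [v] that contain exactly one
    further point of [S] separate those which contain none from those which
    contain several; by Balinski's connectivity argument there are at least
    [d - 1] of them ([balinski_link]). So each removal but the last uses up
    [d - 1] facets that contain two points of [S] ([card_doubly_covered]),
    and [r] with its [d] neighbours come in addition. *)

Set Implicit Arguments.
Unset Strict Implicit.
Unset Printing Implicit Defensive.

Import Order.TTheory GRing.Theory Num.Theory.

Local Open Scope ring_scope.

(** * Scalar products and generic functionals *)

Section dot.
Context {R : comNzRingType} {d : nat}.
Implicit Types x y z : 'rV[R]_d.

Definition dot x y : R := \sum_i x 0 i * y 0 i.

Lemma dotC x y : dot x y = dot y x.
Proof. by apply: eq_bigr => i _; rewrite mulrC. Qed.

Lemma dotDl x y z : dot (x + y) z = dot x z + dot y z.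
Proof. by rewrite -big_split; apply: eq_bigr => i _; rewrite mxE mulrDl. Qed.

Lemma dotZl a x y : dot (a *: x) y = a * dot x y.
Proof. by rewrite mulr_sumr; apply: eq_bigr => i _; rewrite mxE mulrA. Qed.

Lemma dot0l x : dot 0 x = 0.
Proof. by rewrite -(scale0r 0) dotZl mul0r. Qed.

Lemma dotNl x y : dot (- x) y = - dot x y.
Proof. by rewrite -scaleN1r dotZl mulN1r. Qed.

Lemma dotBl x y z : dot (x - y) z = dot x z - dot y z.
Proof. by rewrite dotDl dotNl. Qed.

Lemma dotDr x y z : dot x (y + z) = dot x y + dot x z.
Proof. by rewrite !(dotC x) dotDl. Qed.

Lemma dotZr a x y : dot x (a *: y) = a * dot x y.
Proof. by rewrite !(dotC x) dotZl. Qed.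

Lemma dotNr x y : dot x (- y) = - dot x y.
Proof. by rewrite !(dotC x) dotNl. Qed.

Lemma dotBr x y z : dot x (y - z) = dot x y - dot x z.
Proof. by rewrite !(dotC x) dotBl. Qed.

Lemma dot0r x : dot x 0 = 0.
Proof. by rewrite dotC dot0l. Qed.

Lemma dot_suml (J : Type) (r : seq J) (Q : pred J) (F : J -> 'rV[R]_d) y :
  dot (\sum_(j <- r | Q j) F j) y = \sum_(j <- r | Q j) dot (F j) y.
Proof. by elim/big_rec2: _ => [|j a b _ <-]; rewrite ?dot0l ?dotDl. Qed.

Lemma dot_mulmx x y : dot x y = (x *m y^T) 0 0.
Proof. by rewrite mxE; apply: eq_bigr => i _; rewrite mxE. Qed.

End dot.

Lemma dotvv_gt0 (R : realDomainType) d (w : 'rV[R]_d) : w != 0 -> 0 < dot w w.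
Proof.
move=> w0; rewrite lt_neqAle sumr_ge0 ?andbT => [|i _]; last exact: sqr_ge0.
apply: contra w0; rewrite eq_sym psumr_eq0 => [/allP w0|i _].
  apply/eqP/rowP => i; have := w0 i (mem_index_enum _).
  by rewrite mxE mulf_eq0 orbb => /eqP.
exact: sqr_ge0.
Qed.

Lemma exists_orthogonal (R : fieldType) k d (A : 'M[R]_(k, d)) :
  (\rank A < d)%N -> exists2 c : 'rV[R]_d, c != 0 & forall i,
    dot c (row i A) = 0.
Proof.
move=> rA; have /rowV0Pn[c /sub_kermxP cA c0] : kermx A^T != 0.
  by rewrite kermx_eq0 /row_free mxrank_tr neq_ltn rA.
exists c => // i; rewrite dot_mulmx tr_row.
by move/matrixP/(_ 0 i): cA; rewrite !mxE => cA; rewrite -[RHS]cA;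
  apply: eq_bigr => j _; rewrite !mxE.
Qed.

Section genericity.
Context {R : realFieldType} {d : nat}.
Implicit Types v g w : 'rV[R]_d.

Lemma small_eps (s : seq (R * R)) :
  exists2 e : R, 0 < e & forall x, x \in s -> 0 < x.1 -> 0 < x.1 + e * x.2.
Proof.
suff [e e0 He] : exists2 e : R, 0 < e &
    forall x, x \in s -> 0 < x.1 -> e * `|x.2| < x.1.
  exists e => // x xs x0; have := He x xs x0.
  rewrite -[e in e * `|_|]gtr0_norm // -normrM ltr_norml => /andP[].
  by rewrite ltrNl -subr_gt0 opprK addrC.
elim: s => [|[a b] s [e e0 IH]]; first by exists 1.
have [a0|a0] := ltP 0 a; last first.
  exists e => // x; rewrite inE => /predU1P[-> /=|/IH//].
  by rewrite ltNge a0.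
have b1 : 0 < `|b| + 1 by rewrite ltr_wpDl.
exists (Num.min e (a / (`|b| + 1))); first by rewrite lt_min e0 divr_gt0.
move=> x; rewrite inE => /predU1P[-> /= _|xs x0].
  apply: (@le_lt_trans _ _ (a / (`|b| + 1) * `|b|)).
    by rewrite ler_wpM2r // ge_min lexx orbT.
  by rewrite mulrAC ltr_pdivrMr // ltr_pM2l // ltrDl.
by apply: le_lt_trans (IH x xs x0); rewrite ler_wpM2r // ge_min lexx.
Qed.

Lemma perturb v g (s : seq 'rV[R]_d) : exists2 e : R, 0 < e & forall w,
  w \in s ->
  (0 < dot v w -> 0 < dot (v + e *: g) w) /\
  (dot v w < 0 -> dot (v + e *: g) w < 0).
Proof.
have [e e0 He] := small_eps ([seq (dot v w, dot g w) | w <- s] ++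
  [seq (- dot v w, - dot g w) | w <- s]).
exists e => // w ws; rewrite dotDl dotZl; split=> vw.
  by apply: (He (dot v w, dot g w)) => //; rewrite mem_cat map_f.
rewrite -oppr_gt0 opprD -mulrN.
apply: (He (- dot v w, - dot g w)); rewrite /= ?oppr_gt0 //.
by rewrite mem_cat [X in _ || X](map_f (fun w => (- dot v w, - dot g w))) ?orbT.
Qed.

(** Small moves keep strict signs, so it suffices to move [v] a little along
    a vector on which none of the functionals vanishes; the latter is built
    by the same device, one functional at a time. *)
Lemma exists_generic v (s : seq 'rV[R]_d) : all (fun w => w != 0) s ->
  exists c, forall w, w \in s -> dot c w != 0 /\ (0 < dot v w -> 0 < dot c w).
Proof.
move=> s0; suff [g Hg] : exists g, forall w, w \in s -> dot g w != 0.
  have [e e0 He] := perturb v g s; exists (v + e *: g) => w ws.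
  have [vp vn] := He w ws; split=> //.
  have [/vp/lt0r_neq0//|/vn/ltr0_neq0//|vw] := ltrgtP 0 (dot v w).
  by rewrite dotDl -vw add0r dotZl mulf_neq0 ?Hg // gt_eqF.
elim: s s0 => [|w s IH] /=; first by exists 0.
move=> /andP[w0 /IH[g Hg]].
have [gw|gw] := eqVneq (dot g w) 0; last first.
  by exists g => x; rewrite inE => /predU1P[->|/Hg].
have [e e0 He] := perturb g w s; exists (g + e *: w) => x.
rewrite inE => /predU1P[->|xs].
  by rewrite dotDl gw add0r dotZl gt_eqF // mulr_gt0 // dotvv_gt0.
have [gp gn] := He x xs; have := Hg x xs; rewrite neq_lt => /orP[/gn|/gp].
  exact: ltr0_neq0.
exact: lt0r_neq0.
Qed.

End genericity.

(** * Linear programming on the polar polytope *)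

(** The facets of a simplicial polytope with the origin in its interior,
    described as linear programming on the polar polytope sees them: [normal
    s] is the vertex of the polar dual to the facet [s], [covec s] is the
    basis dual to the vertices of [s], and [exchange] says that the edge of
    the polar which leaves [normal s] in the direction opposite to [covec s
    i] ends at another vertex. A facet is encoded by the set of indices of
    its vertices. *)
Record facet_system (R : realFieldType) (d : nat) (I : finType) := FacetSystem {
  pt : I -> 'rV[R]_d;
  facets : {set {set I}};
  normal : {set I} -> 'rV[R]_d;
  covec : {set I} -> I -> 'rV[R]_d;
  facets_neq0 : exists s, s \in facets;
  card_facet : forall s, s \in facets -> #|s| = d;
  le_normal : forall s i, s \in facets -> dot (pt i) (normal s) <= 1;
  eq_normal : forall s i, s \in facets ->
    (dot (pt i) (normal s) == 1) = (i \in s);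
  covec_pt : forall s i j, s \in facets -> i \in s -> j \in s ->
    dot (pt i) (covec s j) = (i == j)%:R;
  covecK : forall s x, s \in facets ->
    x = \sum_(i in s) dot x (covec s i) *: pt i;
  exchange : forall s i, s \in facets -> i \in s ->
    exists2 t, t \in facets & (t != s) && (s :\ i \subset t)
}.

Section linear_programming.
Context {R : realFieldType} {d : nat} {I : finType}.
Variable X : facet_system R d I.
Implicit Types (c : 'rV[R]_d) (s t f : {set I}) (i j v : I).

Local Notation F := (facets X).
Local Notation u := (normal X).
Local Notation p := (pt X).

(** Up to sign, the slope of the objective [c] along the edge of the polar
    that leaves [normal s] by dropping [i]. *)
Definition coef c s i := dot c (covec X s i).

(** The value of the objective [c] at the vertex of the polar dual to [s]. *)
Definition height c s := dot c (u s).

Lemma coefN c s i : coef (- c) s i = - coef c s i.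
Proof. exact: dotNl. Qed.

Lemma heightN c s : height (- c) s = - height c s.
Proof. exact: dotNl. Qed.

Lemma dot_coef c s w : s \in F ->
  dot c w = \sum_(i in s) coef c s i * dot (p i) w.
Proof.
move=> sF; rewrite {1}(covecK c sF) dot_suml.
by apply: eq_bigr => i _; rewrite dotZl.
Qed.

Lemma normal_eq1 s i : s \in F -> i \in s -> dot (p i) (u s) = 1.
Proof. by move=> sF; rewrite -(eq_normal i sF) => /eqP. Qed.

Lemma normal_lt1 s i : s \in F -> i \notin s -> dot (p i) (u s) < 1.
Proof.
by move=> sF; rewrite -(eq_normal i sF) lt_neqAle le_normal // => ->.
Qed.

Lemma height_coef c s : s \in F -> height c s = \sum_(i in s) coef c s i.
Proof.
move=> sF; rewrite /height (dot_coef _ _ sF); apply: eq_bigr => i is_.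
by rewrite normal_eq1 ?mulr1.
Qed.

Lemma facet_sub_eq s t : s \in F -> t \in F -> s \subset t -> s = t.
Proof.
by move=> sF tF st; apply/eqP;
  rewrite eqEcard st (card_facet sF) (card_facet tF) leqnn.
Qed.

Lemma exchange_notin s t i : s \in F -> t \in F -> i \in s -> t != s ->
  s :\ i \subset t -> i \notin t.
Proof.
move=> sF tF si ts st; apply: contra ts => ti.
rewrite eq_sym; apply/eqP/facet_sub_eq => //.
by rewrite -(setD1K si) subUset sub1set ti.
Qed.

(** Both normals take the value [1] on [s :\ i], so only the coordinate of
    [c] at [i] sees the difference. *)
Lemma height_exchange c s t i : s \in F -> t \in F -> i \in s ->
  s :\ i \subset t ->
  height c t = height c s - coef c s i * (1 - dot (p i) (u t)).
Proof.
move=> sF tF si st; rewrite (height_coef _ sF) /height (dot_coef _ _ sF).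
rewrite !(bigD1 i si) /= (eq_bigr (fun j => coef c s j)) => [|j /andP[sj ji]].
  ring.
by rewrite normal_eq1 ?mulr1 //; apply: (subsetP st); rewrite !inE ji.
Qed.

(** Optimality criterion, inside the face of the polar dual to [f]: expand
    [c] in the basis [s]; on [f] both normals are [1], and elsewhere no
    normal exceeds the value [1] of [normal s]. *)
Lemma height_le_top c s t f : s \in F -> t \in F -> f \subset t ->
  (forall i, i \in s -> i \notin f -> 0 <= coef c s i) ->
    height c t <= height c s.
Proof.
move=> sF tF ft c0; rewrite (height_coef _ sF) /height (dot_coef _ _ sF).
apply: ler_sum => i si; have [/(subsetP ft)/(normal_eq1 tF)->|fi] :=
  boolP (i \in f).
  by rewrite mulr1.
by apply: ler_piMr; [exact: c0 | exact: le_normal].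
Qed.

Lemma top_unique c s t f : s \in F -> t \in F -> f \subset s -> f \subset t ->
  (forall i, i \in s -> i \notin f -> 0 < coef c s i) ->
    height c s <= height c t ->
  t = s.
Proof.
move=> sF tF fs ft c0;
  rewrite (height_coef _ sF) /height (dot_coef _ _ sF) => le.
have le1 i : i \in s -> coef c s i * dot (p i) (u t) <= coef c s i.
  move=> si; have [/(subsetP ft)/(normal_eq1 tF)->|fi] := boolP (i \in f).
    by rewrite mulr1.
  by apply: ler_piMr; [apply/ltW/c0 | exact: le_normal].
apply/esym/facet_sub_eq => //; apply/subsetP => i si.
have [/(subsetP ft)//|fi] := boolP (i \in f).
apply/negPn/negP => ti; move: le; rewrite leNgt => /negP; apply.
rewrite !(bigD1 i si) /=; apply: ltr_leD.
  by rewrite gtr_pMr ?normal_lt1 ?c0.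
by apply: ler_sum => j /andP[/le1].
Qed.

Lemma improve c s i : s \in F -> i \in s -> coef c s i < 0 ->
  exists t, [/\ t \in F, t != s, s :\ i \subset t & height c s < height c t].
Proof.
move=> sF si ci; have [t tF /andP[ts st]] := exchange sF si.
exists t; split=> //; rewrite (height_exchange c sF tF si st) ltrDl oppr_gt0.
by rewrite nmulr_rlt0 // subr_gt0 normal_lt1 // (exchange_notin sF).
Qed.

Lemma subsetD1_face f s t i : f \subset s -> i \notin f -> s :\ i \subset t ->
  f \subset t.
Proof.
move=> fs fi; apply: subset_trans; apply/subsetP => j fj.
by rewrite !inE (subsetP fs) // andbT; apply: contraNneq fi => <-.
Qed.

(** A maximum of [c] on the face of the polar dual to [f] has no increasing
    edge in that face. *)
Lemma exists_top c f : (exists2 s, s \in F & f \subset s) ->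
  exists s, [/\ s \in F, f \subset s
    & forall i, i \in s -> i \notin f -> 0 <= coef c s i].
Proof.
move=> [s0 s0F fs0].
pose P s := (s \in F) && (f \subset s).
have Ps0 : P s0 by rewrite /P s0F.
have [s /andP[sF fs] smax] := @arg_maxP _ _ _ s0 P (height c) Ps0.
exists s; split=> // i si fi; rewrite leNgt; apply/negP => /(improve sF si).
move=> [t [tF _ st]]; apply/negP; rewrite -leNgt; apply: smax.
by rewrite /P tF (subsetD1_face fs fi st).
Qed.

(** The cones over the facets cover the space. *)
Lemma exists_cone c : exists2 s, s \in F & forall i, i \in s -> 0 <= coef c s i.
Proof.
have [s0 s0F] := facets_neq0 X.
have [|s [sF _ cs]] := @exists_top c set0; first by exists s0; rewrite ?sub0set.
by exists s => // i si; apply: cs; rewrite ?inE.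
Qed.

Definition generic c := forall s i, s \in F -> i \in s -> coef c s i != 0.

Lemma genericN c : generic c -> generic (- c).
Proof. by move=> cg s i sF si; rewrite coefN oppr_eq0 cg. Qed.

(** The linear forms [coef _ s i] are nonzero, as [covec s i] takes the value
    [1] at [pt X i]. *)
Lemma exists_generic_near x : exists2 c, generic c &
  forall s i, s \in F -> i \in s -> 0 < coef x s i -> 0 < coef c s i.
Proof.
pose L := [seq covec X y.1 y.2 |
  y <- enum [pred y : {set I} * I | (y.1 \in F) && (y.2 \in y.1)]].
have inL s i : s \in F -> i \in s -> covec X s i \in L.
  by move=> sF si; apply/mapP; exists (s, i) => //; rewrite mem_enum inE /= sF.
have L0 : all (fun w => w != 0) L.
  apply/allP => w /mapP[[s i]]; rewrite mem_enum inE /= => /andP[sF si] ->.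
  apply/eqP => w0; have := covec_pt sF si si.
  by rewrite w0 dot0r eqxx => /eqP; rewrite eq_sym oner_eq0.
have [c Hc] := exists_generic x L0.
by exists c => s i sF si; have [] := Hc _ (inL _ _ sF si).
Qed.

Definition vertex_set := \bigcup_(s in F) s.

Lemma vertex_setP v : reflect (exists2 s, s \in F & v \in s) (v \in vertex_set).
Proof. by apply: (iffP bigcupP) => -[s]; exists s. Qed.

End linear_programming.

(** * The upper bound theorem *)

(** The matrix of the ['C(e - k, e - m)] is triangular with unit diagonal. *)
Lemma binomial_transform_inj (e : nat) (h h' : nat -> nat) :
  (forall m, (m <= e)%N -> \sum_(k < e.+1) h k * 'C(e - k, m) =
    \sum_(k < e.+1) h' k * 'C(e - k, m))%N ->
  forall k, (k <= e)%N -> h k = h' k.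
Proof.
move=> H; elim/ltn_ind => k IH ke; have := H _ (leq_subr k e).
have split_at (g : nat -> nat) : (\sum_(j < e.+1) g j * 'C(e - j, e - k) =
    \sum_(j < e.+1 | j < k) g j * 'C(e - j, e - k) + g k)%N.
  rewrite (bigID (fun j : 'I_e.+1 => (j < k)%N)) /=; congr (_ + _)%N.
  have ke' : (k < e.+1)%N by [].
  rewrite (bigD1 (Ordinal ke')) /= ?ltnn // binn muln1 big1 ?addn0 // => j.
  rewrite -leqNgt => /andP[kj]; rewrite -val_eqE /= => jk.
  by rewrite bin_small ?muln0 //; have := ltn_ord j; lia.
rewrite !split_at => /eqP.
rewrite (eq_bigr (fun j : 'I_e.+1 => h' j * 'C(e - j, e - k))%N).
  by rewrite eqn_add2l => /eqP.
by move=> j jk; rewrite IH //; lia.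
Qed.

Lemma sum_count_image (T : finType) (A : {set T}) (k : T -> nat) (e : nat)
    (G : nat -> nat) : (forall x, x \in A -> k x <= e)%N ->
  (\sum_(x in A) G (k x) = \sum_(j < e.+1) #|[set x in A | k x == j]| * G j)%N.
Proof.
move=> ke; rewrite (partition_big (fun x => inord (k x) : 'I_e.+1) xpredT) //=.
apply: eq_bigr => j _; rewrite -sum_nat_const.
have E x : (x \in A) && (inord (k x) == j) = (x \in [set x in A | k x == j]).
  rewrite inE; case xA : (x \in A) => //=.
  by rewrite -val_eqE /= inordK // ltnS ke.
by rewrite (eq_bigl _ _ E); apply: eq_bigr => x; rewrite inE => /andP[_ /eqP->].
Qed.

Lemma card_interval (T : finType) (a s : {set T}) m : a \subset s ->
  #|[set f : {set T} | (a \subset f) && (f \subset s) & #|s :\: f| == m]| =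
  'C(#|s :\: a|, m).
Proof.
move=> sa; have KD (f : {set T}) : f \subset s -> s :\: (s :\: f) = f.
  by move=> fs; rewrite setDDr setDv set0U; apply/setIidPr.
rewrite -cards_draws -(card_in_imset (f := fun f : {set T} => s :\: f));
  last first.
  move=> f g; rewrite !inE => /andP[/andP[_ fs] _] /andP[/andP[_ gs] _] E.
  by rewrite -(KD f) // E KD.
apply: eq_card => b; apply/imsetP/idP => [[f]|].
  by rewrite !inE => /andP[/andP[af fs] fm] ->; rewrite setDS.
rewrite !inE => /andP[bs bm].
have bs' : b \subset s := subset_trans bs (subsetDl _ _).
exists (s :\: b); last by rewrite KD.
rewrite !inE subsetDl subsetD sa andbT KD // bm andbT.
by move: bs; rewrite subsetD disjoint_sym => /andP[].
Qed.

Section upper_bound.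
Context {R : realFieldType} {d : nat} {I : finType}.
Variable X : facet_system R d I.
Implicit Types (c : 'rV[R]_d) (s t f : {set I}) (i j v : I).

Local Notation F := (facets X).
Local Notation coef := (coef X).
Local Notation generic := (generic X).

Definition neg_coefs c s := [set i in s | coef c s i < 0].

(** For a generic [c], the [k]-th entry of the [h]-vector of the link of [f],
    read off from the orientation that [c] induces on the graph of the face
    of the polar dual to [f]. *)
Definition hnum f c k :=
  #|[set s in F | f \subset s & #|neg_coefs c s :\: f| == k]|.

Lemma pos_coef c s f i : generic c -> s \in F -> neg_coefs c s \subset f ->
  i \in s -> i \notin f -> 0 < coef c s i.
Proof.
move=> cg sF nf si fi; rewrite lt_neqAle eq_sym cg // leNgt /=.
by apply: contra fi => ci; apply: (subsetP nf); rewrite inE si.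
Qed.

(** A generic objective has a unique maximum on the face of the polar dual to
    [f], and the facet [s] is that maximum exactly when the negative
    coordinates of [c] in [s] belong to [f]. *)
Lemma card_top_facets c f : generic c -> (exists2 s, s \in F & f \subset s) ->
  #|[set s in F | (neg_coefs c s \subset f) && (f \subset s)]| = 1%N.
Proof.
move=> cg /(exists_top c)[s [sF fs cs]]; apply/eqP/cards1P; exists s.
apply/setP => t; rewrite !inE; apply/and3P/eqP => [[tF nt ft]|->].
  apply/(top_unique (c := c) sF tF fs ft).
    by move=> i si fi; rewrite lt_neqAle eq_sym cg // cs.
  by apply: (height_le_top tF sF fs) => i ti fi; apply/ltW/(pos_coef cg tF nt).
split=> //; apply/subsetP => i; rewrite inE => /andP[si]; rewrite ltNge.
by apply: contraR; apply: cs.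
Qed.

(** Both sides count the faces [t] that contain [f] and have codimension [m]:
    group the faces by their top facet [s], which leaves the choice of the
    [m] elements of [s :\: t] among the nonnegative coordinates outside [f]. *)
Lemma sum_hnum_bin c c' f m : generic c -> generic c' ->
  (\sum_(k < (d - #|f|).+1) hnum f c k * 'C(d - #|f| - k, m) =
  \sum_(k < (d - #|f|).+1) hnum f c' k * 'C(d - #|f| - k, m))%N.
Proof.
suff H c0 : generic c0 ->
  (\sum_(k < (d - #|f|).+1) hnum f c0 k * 'C(d - #|f| - k, m) =
   #|[set t : {set I} | [&& [exists s in F, t \subset s],
     f \subset t & (#|t| + m == d)]]|)%N.
  by move=> cg cg'; rewrite !H.
move=> cg; rewrite -sum1dep_card.
have ndiff s : s \in F -> f \subset s ->
    #|s :\: (neg_coefs c0 s :|: f)| = (d - #|f| - #|neg_coefs c0 s :\: f|)%N.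
  move=> sF fs; rewrite cardsD (setIidPr _) ?subUset ?fs ?andbT; last first.
    by apply/subsetP => i; rewrite inE => /andP[].
  by rewrite (card_facet sF) cardsU -subnDA cardsD;
    have := subset_leq_card (subsetIl (neg_coefs c0 s) f); lia.
transitivity (\sum_(s in [set s in F | f \subset s])
    \sum_(t : {set I} | [&& neg_coefs c0 s \subset t, t \subset s,
      f \subset t & (#|t| + m == d)]) 1)%N.
  rewrite (eq_bigr (fun s => 'C(d - #|f| - #|neg_coefs c0 s :\: f|, m)));
    last first.
    move=> s; rewrite inE => /andP[sF fs];
      rewrite -ndiff // sum1dep_card -card_interval.
      apply: eq_card => t; rewrite !inE subUset;
        have [ts|] := boolP (t \subset s).
        rewrite andbT -!andbA; do 2!congr (_ && _).
        rewrite cardsD (setIidPr ts) (card_facet sF).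
        have := subset_leq_card ts; rewrite (card_facet sF); lia.
      by rewrite !andbF.
    by rewrite subUset fs andbT; apply/subsetP => i; rewrite inE => /andP[].
  rewrite (@sum_count_image _ _ (fun s => #|neg_coefs c0 s :\: f|) (d - #|f|)
     (fun k => 'C(d - #|f| - k, m))).
    apply: eq_bigr => k _; congr (_ * _)%N; rewrite /hnum.
    by apply: eq_card => s; rewrite !inE andbA.
  move=> s; rewrite inE => /andP[sF fs].
  have -> : (d - #|f|)%N = #|s :\: f|.
    by rewrite cardsD (setIidPr fs) (card_facet sF).
  by apply/subset_leq_card/setSD/subsetP => i; rewrite inE => /andP[].
rewrite (exchange_big_dep
  (fun t : {set I} => [&& [exists s in F, t \subset s],
  f \subset t & (#|t| + m == d)])) /=; last first.
  move=> s t; rewrite inE => /andP[sF fs] /and4P[_ ts ft ->]; rewrite ft !andbT.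
  by apply/existsP; exists s; rewrite sF.
apply: eq_bigr => t /and3P[/existsP[s /andP[sF ts]] ft tm].
rewrite sum1dep_card -(@card_top_facets c0 t) //; last by exists s.
apply: eq_card => s'; rewrite !inE ft tm !andbT.
case: (s' \in F) => //=; have [ts'|] := boolP (t \subset s');
  last by rewrite !andbF.
by rewrite (subset_trans ft ts').
Qed.

Lemma hnum_indep c c' f k : generic c -> generic c' -> (k <= d - #|f|)%N ->
  hnum f c k = hnum f c' k.
Proof.
move=> cg cg'; apply: (binomial_transform_inj (e := (d - #|f|)%N)).
by move=> m _; apply: sum_hnum_bin.
Qed.

Lemma hnum0 c : generic c -> hnum set0 c 0 = 1%N.
Proof.
move=> cg; have [s0 s0F] := facets_neq0 X.
rewrite -(@card_top_facets c set0 cg); last by exists s0; rewrite ?sub0set.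
apply: eq_card => s; rewrite !inE setD0 sub0set andbT cards_eq0.
by rewrite subset0.
Qed.

(** The Dehn-Sommerville equations: changing the sign of [c] exchanges
    negative and positive coordinates. *)
Lemma hnumN c k : generic c -> (k <= d)%N ->
  hnum set0 (- c) (d - k)%N = hnum set0 c k.
Proof.
move=> cg kd; apply: eq_card => s; rewrite !inE !setD0 sub0set.
have [sF|//] := boolP (s \in F); rewrite /=.
have -> : neg_coefs (- c) s = s :\: neg_coefs c s.
  apply/setP => i; rewrite !inE; have [si|] := boolP (i \in s);
    rewrite ?andbF //=.
  by rewrite andbT coefN oppr_lt0 -leNgt lt_neqAle eq_sym cg.
have ns : neg_coefs c s \subset s by apply/subsetP => i; rewrite inE => /andP[].
rewrite cardsD (setIidPr ns) (card_facet sF).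
by have := subset_leq_card ns; rewrite (card_facet sF); lia.
Qed.

(** A facet with [m] negative coordinates contributes to the link of each of
    its vertices: with [m - 1] at the [m] negative ones and with [m] at the
    other [d - m]. *)
Lemma sum_hnum_link c k : (k < d)%N ->
  (\sum_(v in vertex_set X) hnum [set v] c k =
   k.+1 * hnum set0 c k.+1 + (d - k) * hnum set0 c k)%N.
Proof.
move=> kd.
transitivity (\sum_(s in F) #|[set v in s | #|neg_coefs c s :\ v| == k]|)%N.
  rewrite (eq_bigr (fun v
    => \sum_(s in F) ((v \in s) && (#|neg_coefs c s :\ v| == k)))%N);
    last first.
    move=> v _; rewrite /hnum -sum1dep_card big_mkcondr /=.
    by apply: eq_bigr => s _; rewrite sub1set; case: (_ && _).
  rewrite exchange_big /=; apply: eq_bigr => s sF.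
  rewrite -sum1dep_card big_mkcond [RHS]big_mkcond; apply: eq_bigr => v _.
  have [vX|] := boolP (v \in vertex_set X); first by case: (_ && _).
  have [vs /negP[]|_ _] := boolP (v \in s); last by [].
  by apply/vertex_setP; exists s.
transitivity (\sum_(s in F)
  (k.+1 * (#|neg_coefs c s| == k.+1) + (d - k) * (#|neg_coefs c s| == k)))%N.
  apply: eq_bigr => s sF.
  have ns : neg_coefs c s \subset s by apply/subsetP => i;
    rewrite inE => /andP[].
  have nd : (#|neg_coefs c s| <= d)%N by rewrite -(card_facet sF)
    subset_leq_card.
  rewrite -(cardsID (neg_coefs c s)); congr (_ + _)%N.
    rewrite (_ : _ :&: _ = if #|neg_coefs c s| == k.+1 then neg_coefs c s else
      set0).
      by case: ifP => [/eqP->|_]; rewrite ?cards0 ?muln1 ?muln0.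
    apply/setP => v; rewrite !inE (fun_if (fun A : {set I} => v \in A)) !inE.
    case: (boolP (v \in s)) => //= vs; last by rewrite if_same.
    case: (boolP (coef c s v < 0)) => vn; rewrite ?andbF ?if_same // andbT.
    have vN : v \in neg_coefs c s by rewrite inE vs.
    by rewrite (cardsD1 v (neg_coefs c s)) vN add1n eqSS; case: eqP.
  rewrite (_ : _ :\: _ = if #|neg_coefs c s| == k then s :\: neg_coefs c s else
    set0).
    case: ifP => [/eqP nk|_]; rewrite ?cards0 ?muln0 // muln1.
    by rewrite cardsD (setIidPr ns) (card_facet sF) nk.
  apply/setP => v; rewrite !inE (fun_if (fun A : {set I} => v \in A)) !inE.
  case: (boolP (v \in s)) => //= vs; last by rewrite ?andbF if_same.
  case: (boolP (coef c s v < 0)) => //= vn; first by rewrite if_same.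
  have vN : v \notin neg_coefs c s by rewrite inE vs.
  by rewrite (cardsD1 v (neg_coefs c s)) (negbTE vN) add0n; case: eqP.
rewrite big_split -!big_distrr /= /hnum.
by congr (_ * _ + _ * _)%N; rewrite -sum1dep_card big_mkcondr /=;
  apply: eq_bigr => s _; rewrite setD0 sub0set.
Qed.

(** The [h]-numbers do not depend on the objective; for one close to [pt X
    v], the coordinate at [v] is positive in every facet that contains [v],
    so the negative coordinates are the same in the link and in the whole. *)
Lemma hnum_link_le c v k : generic c -> (k < d)%N ->
  (hnum [set v] c k <= hnum set0 c k)%N.
Proof.
move=> cg kd; have [c' cg' Hc'] := exists_generic_near X (pt X v).
rewrite (@hnum_indep c c') // ?cards1; last by lia.
rewrite (@hnum_indep c c' set0) // ?cards0; last by lia.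
apply: subset_leq_card; apply/subsetP => s; rewrite !inE sub1set sub0set setD0.
move=> /and3P[sF vs nk]; rewrite sF /=; move: nk.
suff vN : v \notin neg_coefs c' s.
  rewrite (_ : _ :\ v = neg_coefs c' s) //.
  by apply/setDidPl; rewrite disjoint_sym disjoints1.
rewrite inE vs -leNgt ltW //=; apply: Hc' => //.
by rewrite /coef covec_pt // eqxx ltr01.
Qed.

Local Notation n := #|vertex_set X|.

Lemma card_vertex_set : (0 < d)%N -> (d < n)%N.
Proof.
move=> d0; have [s sF] := facets_neq0 X.
have /card_gt0P[i si] : (0 < #|s|)%N by rewrite (card_facet sF).
have [t tF /andP[ts st]] := exchange sF si.
rewrite -[X in (X < _)%N](card_facet sF); apply: proper_card.
have sX t' : t' \in F -> t' \subset vertex_set X.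
  by move=> t'F; apply/subsetP => j jt'; apply/vertex_setP; exists t'.
rewrite properE sX //=; apply: contra ts => Xs.
by rewrite eqEcard (subset_trans (sX _ tF)) // (card_facet sF) (card_facet tF)
  leqnn.
Qed.

(** Induction on [k], through [(k + 1) h_(k+1) + (d - k) h_k <= n h_k]. *)
Lemma hnum_le_bin c k : generic c -> (0 < d)%N -> (k <= d)%N ->
  (hnum set0 c k <= 'C(n - d.+1 + k, k))%N.
Proof.
move=> cg d0; have nd := card_vertex_set d0.
elim: k => [_|k IH kd]; first by rewrite hnum0 // bin0.
have {}IH := IH (ltnW kd).
have : (k.+1 * hnum set0 c k.+1 + (d - k) * hnum set0 c k
  <= n * hnum set0 c k)%N.
  rewrite -sum_hnum_link // -sum_nat_const.
  by apply: leq_sum => v vX; apply: hnum_link_le.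
move=> le; rewrite -(leq_pmul2l (ltn0Sn k)) -mul_bin_diag.
apply: (@leq_trans ((n - d + k) * hnum set0 c k)%N).
  rewrite -(leq_add2r ((d - k) * hnum set0 c k)%N) -mulnDl.
  by rewrite (_ : n - d + k + (d - k) = n)%N //; lia.
have -> : (n - d.+1 + k.+1 = n - d + k)%N by lia.
have -> : (n - d + k).-1 = (n - d.+1 + k)%N by lia.
by rewrite leq_mul2l IH orbT.
Qed.

Lemma sum_bin_diag a m : (\sum_(k < m.+1) 'C(a + k, k) = 'C(a + m.+1, a.+1))%N.
Proof.
elim: m => [|m IH]; first by rewrite big_ord1 addn0 bin0 addn1 binn.
rewrite big_ord_recr /= IH [in RHS]addnS binS; congr (_ + _)%N.
by rewrite -(bin_sub (leq_addr m.+1 a)) addKn.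
Qed.

(** The facets are counted by the sum of the [h_k]; the first half is bounded
    by [hnum_le_bin], the second half too after Dehn-Sommerville, and each
    half of the binomial sum telescopes. *)
Theorem facets_upper_bound : (0 < d)%N ->
  (#|F| <= 'C(n - (d + 1) %/ 2, n - d) + 'C(n - (d + 2) %/ 2, n - d))%N.
Proof.
move=> d0; have nd := card_vertex_set d0.
have [c cg _] := exists_generic_near X 0.
have -> : #|F| = (\sum_(k < d.+1) hnum set0 c k)%N.
  rewrite -sum1_card (sum_count_image (k := fun s => #|neg_coefs c s|) (e := d)
    (fun=> 1%N)).
    apply: eq_bigr => k _; rewrite muln1 /hnum; apply: eq_card => s.
    by rewrite !inE sub0set setD0.
  by move=> s sF; rewrite -(card_facet sF); apply/subset_leq_card/subsetP => i;
    rewrite inE => /andP[].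
pose a := (n - d.+1)%N.
have -> : 'C(n - (d + 1) %/ 2, n - d) = (\sum_(k < (d %/ 2).+1) 'C(a + k, k))%N.
  by rewrite sum_bin_diag; congr 'C(_, _); rewrite /a; lia.
have -> : 'C(n - (d + 2) %/ 2, n - d)
  = (\sum_(k < (d - d %/ 2)) 'C(a + k, k))%N.
  rewrite -(prednK (n := d - d %/ 2)); last by lia.
  by rewrite sum_bin_diag; congr 'C(_, _); rewrite /a; lia.
rewrite -(big_mkord xpredT (hnum set0 c)) (@big_cat_nat _ _ _ (d %/ 2).+1) //=;
  last by lia.
apply: leq_add.
  by rewrite big_mkord; apply: leq_sum => k _; apply: hnum_le_bin => //;
    have := ltn_ord k; lia.
rewrite big_nat_rev /= -{1}[(d %/ 2).+1]add0n big_addn big_mkord subSS.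
apply: leq_sum => k _.
have -> : (0 + (d %/ 2).+1 + d.+1 - (k + (d %/ 2).+1).+1 = d - k)%N by lia.
have kd : (k <= d)%N by have := ltn_ord k; lia.
by rewrite -[c]opprK hnumN ?hnum_le_bin //; apply: genericN.
Qed.

End upper_bound.

(** * Paths in the graph of the polar polytope *)

Section reachability.
Context {T : finType} (e : rel T).

Lemma connect_ind (P : T -> Prop) x y : P x ->
  (forall a b, connect e x a -> P a -> e a b -> P b) -> connect e x y -> P y.
Proof.
move=> Px step /connectP[q + ->]; elim/last_ind: q => //= q b IH.
rewrite rcons_path last_rcons => /andP[pq eb]; apply: step eb; last exact: IH.
by apply/connectP; exists q.
Qed.

Lemma connect_exit (P : pred T) x y : connect e x y -> P x -> ~~ P y ->
  exists a b, [/\ e a b, P a & ~~ P b].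
Proof.
move=> /connectP[q + ->]; elim: q x => [|z q IH] x /=; first by move=> _ ->.
move=> /andP[xz pq] Px; have [Pz|Pz _] := boolP (P z); first exact: IH pq Pz.
by exists x, z.
Qed.

End reachability.

Section lower_bound.
Context {R : realFieldType} {d : nat} {I : finType}.
Variable X : facet_system R d I.
Implicit Types (c : 'rV[R]_d) (s t f S : {set I}) (i j v : I).

Local Notation F := (facets X).
Local Notation u := (normal X).
Local Notation p := (pt X).
Local Notation coef := (coef X).
Local Notation height := (height X).

Definition adjacent s t := (s \in F) && (t \in F) && (#|t :\: s| == 1%N).

Lemma adjacentC s t : adjacent s t = adjacent t s.
Proof.
rewrite /adjacent [in RHS](andbC (t \in F)); apply: andb_id2l => /andP[sF tF].
by rewrite !cardsD setIC (card_facet sF) (card_facet tF).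
Qed.

Lemma adjacent_exchange s t i : s \in F -> t \in F -> t != s ->
  s :\ i \subset t ->
  adjacent s t.
Proof.
move=> sF tF ts st; rewrite /adjacent sF tF /=.
have : (0 < #|s :\: t|)%N.
  by rewrite card_gt0 setD_eq0; apply: contra ts => st';
    apply/eqP/esym/(facet_sub_eq sF tF st').
have : (#|s :\: t| <= 1)%N.
  rewrite -(cards1 i); apply/subset_leq_card/subsetP => j;
    rewrite !inE => /andP[jt js].
  by apply: contraR jt => ji; apply: (subsetP st); rewrite !inE ji.
rewrite !cardsD setIC (card_facet sF) (card_facet tF); lia.
Qed.

(** One step between neighbouring facets that contain [f], at or above the
    level [m] of the objective [c]. *)
Definition above f c (m : R) : rel {set I} := fun s t =>
  [&& adjacent s t, f \subset s, f \subset t, m <= height c s & m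
    <= height c t].

Lemma above_sym f c m : connect_sym (above f c m).
Proof.
apply: sym_connect_sym => s t; rewrite /above adjacentC.
by congr (_ && _); rewrite !andbA [(f \subset s) && _]andbC -!andbA;
  congr [&& _, _ & _]; rewrite andbC.
Qed.

(** The simplex method: from every facet, climb to a maximum without
    descending. As [c] may have several maxima on the face dual to [f], the
    objective is perturbed by a small multiple of the sum of the vertices of
    one of them, [top]; this makes [top] the only maximum, and no strict
    comparison of heights is reversed. *)
Lemma exists_summit f c : (exists2 s, s \in F & f \subset s) ->
  exists2 top, top \in F & forall m s, s \in F -> f \subset s ->
    m <= height c s ->
    connect (above f c m) s top.
Proof.
move=> /(exists_top c)[top [topF ftop ctop]]; exists top => // m.
pose g := \sum_(i in top) p i.
have [e e0 He] := perturb c g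
  [seq u x.2 - u x.1 | x <- enum [set: {set I} * {set I}]].
pose c' := c + e *: g.
have mono s t : height c s < height c t -> height c' s < height c' t.
  rewrite -![height _ s < _]subr_gt0 /height -!dotBr => st.
  have [] := He (u t - u s); last by move=> + _; apply.
  by apply/mapP; exists (s, t); rewrite ?mem_enum ?inE.
have top' i : i \in top -> i \notin f -> 0 < coef c' top i.
  move=> it fi; rewrite /coef dotDl dotZl dot_suml (bigD1 i) //= covec_pt //
    eqxx.
  rewrite big1 => [|j /andP[jt ji]]; last by rewrite covec_pt // (negbTE ji).
  by rewrite addr0 mulr1 ltr_wpDl // ctop.
pose better s := [set t in F | (f \subset t) && (height c' s < height c' t)].
(* induction on the number of facets above s for the perturbed objective *)
move=> s; have [k] := ubnP #|better s|; elim: k s => // k IH s sk sF fs ms.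
have [->|st] := eqVneq s top; first exact: connect0.
have [i si /andP[fi ci]] : exists2 i, i \in s & (i \notin f)
  && (coef c' s i < 0).
  apply/exists_inP; apply: contra_neqT st => /exists_inPn H.
  apply: (top_unique topF sF ftop fs top'); apply: (height_le_top sF topF ftop).
  by move=> i si fi; move: (H i si); rewrite fi /= -leNgt.
have [t [tF ts st' vst]] := improve sF si ci.
have ft := subsetD1_face fs fi st'.
have mt : m <= height c t.
  by apply: le_trans ms _; rewrite leNgt; apply/negP => /mono;
    rewrite ltNge ltW.
apply: (connect_trans (y := t)).
  by apply: connect1; rewrite /above (adjacent_exchange sF tF ts st') fs ft ms.
apply: IH => //; apply: leq_trans (_ : #|better s| <= k)%N; last by [].
apply: proper_card; apply/properP; split.
  by apply/subsetP => x; rewrite !inE => /and3P[-> -> /(lt_trans vst)->].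
by exists t; rewrite !inE tF ft ?vst // ltxx.
Qed.

Lemma connect_above f c m s t : s \in F -> t \in F -> f \subset s ->
  f \subset t ->
  m <= height c s -> m <= height c t -> connect (above f c m) s t.
Proof.
move=> sF tF fs ft ms mt.
have [top _ H] := @exists_summit f c (ex_intro2 _ _ s sF fs).
by apply: connect_trans (H _ _ sF fs ms) _; rewrite above_sym; apply: H.
Qed.

Lemma connect_facets (Q : pred {set I}) c s t : s \in F -> t \in F ->
  (forall x, x \in F -> Num.min (height c s) (height c t) <= height c x -> Q x)
    ->
  connect [rel a b | [&& adjacent a b, Q a & Q b]] s t.
Proof.
move=> sF tF HQ; set m := Num.min _ _ in HQ.
have : connect (above set0 c m) s t.
  by apply: connect_above; rewrite ?sub0set // ge_min lexx ?orbT.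
apply: connect_sub => a b /and5P[ab _ _ ma mb]; apply: connect1 => /=.
by move: (ab) => /andP[/andP[aF bF] _]; rewrite ab !HQ.
Qed.

(** The facets that contain [v] are the minima of the objective [- pt X v]. *)
Lemma connect_avoid_vertex v s t : s \in F -> t \in F -> v \notin s ->
  v \notin t ->
  connect [rel a b | [&& adjacent a b, v \notin a & v \notin b]] s t.
Proof.
move=> sF tF vs vt; apply:
  (connect_facets (Q := fun x => v \notin x) (c := - p v)) => // x xF.
apply: contraL => vx; rewrite -ltNge !heightN /height (normal_eq1 xF vx) lt_min.
by rewrite !ltrN2 !normal_lt1.
Qed.

(** The sum of the vertices of [r] has its only maximum at [r]. *)
Lemma connect_avoid_facet r s t : r \in F -> s \in F -> t \in F -> s != r ->
  t != r ->
  connect [rel a b | [&& adjacent a b, a != r & b != r]] s t.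
Proof.
move=> rF sF tF sr tr; pose c := \sum_(i in r) p i.
have cr x : x \in F -> x != r -> height c x < height c r.
  move=> xF; rewrite ltNge; apply: contra => le; apply/eqP.
  apply: (top_unique (f := set0) (c := c) rF xF); rewrite ?sub0set // => i ir _.
  rewrite /coef dot_suml (bigD1 i) //= covec_pt // eqxx big1 ?addr0 //.
  by move=> j /andP[jr ji]; rewrite covec_pt // (negbTE ji).
apply: (connect_facets (Q := fun x => x != r) (c := - c)) => // x xF.
by apply: contraL => /eqP->; rewrite -ltNge !heightN lt_min !ltrN2 !cr.
Qed.

(** The normals of the facets through the ridge [f] lie on a line with
    [normal r] at an end. If [normal s] lay between [normal r] and [normal
    t], a vertex of [s] outside [r] would take a value greater than [1] at
    [normal t]. *)
Lemma ridge_two_facets r s t f : r \in F -> s \in F -> t \in F ->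
  f \subset r -> f \subset s -> f \subset t -> #|f| = d.-1 ->
  s != r -> t != r -> s = t.
Proof.
move=> rF + + fr + + fd; wlog [i ri] : / exists i, r :\: f = [set i].
  have [d0|d0] := posnP d.
    move=> _ sF _ _ _ /eqP[]; apply: (facet_sub_eq sF rF).
    by have /eqP := card_facet sF; rewrite d0 cards_eq0 => /eqP->;
      apply: sub0set.
  apply; apply/cards1P; rewrite cardsD (setIidPr fr) (card_facet rF) fd; lia.
have ir : i \in r by have := set11 i; rewrite -ri !inE => /andP[].
have rf : r :\ i \subset f.
  apply/subsetP => j; rewrite !inE => /andP[ji jr]; apply: contraNT ji => jf.
  by rewrite -in_set1 -ri inE jf.
(* the value at i of the normal measures the distance from normal r along the
   line *)
wlog le : s t / dot (p i) (u t) <= dot (p i) (u s).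
  have [le|/ltW le] := leP (dot (p i) (u t)) (dot (p i) (u s)); first exact.
  by move=> H sF tF fs ft sr tr; apply/esym/H.
move=> sF tF fs ft sr tr; apply: (facet_sub_eq sF tF); apply/subsetP => j js.
have rs := subset_trans rf fs; have rt := subset_trans rf ft.
have is_ := exchange_notin rF sF ir sr rs.
have [jr|jr] := boolP (j \in r).
  by apply: (subsetP rt); rewrite !inE jr andbT; apply: contraNneq is_ => <-.
have := height_exchange (p j) rF sF ir rs;
  have := height_exchange (p j) rF tF ir rt.
have := normal_lt1 rF jr; have := normal_lt1 sF is_; have := le_normal j tF.
rewrite -(eq_normal j tF) /height (normal_eq1 sF js).
set A := dot (p i) (u s) in le *; set B := dot (p i) (u t) in le *.
set C := dot (p j) (u r); set D := dot (p j) (u t).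
move: (coef (p j) r i) => E D1 A1 C1 DE CE; rewrite eq_le D1 /=.
have E0 : E < 0 by rewrite -(pmulr_llt0 E (x := 1 - A)); lra.
by rewrite DE; nra.
Qed.

(** * The lower bound theorem *)

Lemma adjacent_cardI s t S : adjacent s t -> (#|t :&: S| <= #|s :&: S|.+1)%N.
Proof.
move=> /andP[_ /eqP st]; rewrite -(cardsID s (t :&: S)) -addn1 leq_add //.
  by rewrite subset_leq_card // setIAC setSI // subsetIr.
by rewrite -st subset_leq_card // setSD // subsetIl.
Qed.

(** Exchanging distinct elements of [A] leads from [s] to distinct facets. *)
Lemma card_exchange s (A : {set I}) (Q : {set {set I}}) : s \in F ->
  A \subset s -> s \in Q ->
  (forall i t, i \in A -> t \in F -> t != s -> s :\ i \subset t -> t \in Q) ->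
  (#|A| < #|Q|)%N.
Proof.
move=> sF As sQ HQ.
pose nb i := odflt s [pick t in F | (t != s) && (s :\ i \subset t)].
have nbP i : i \in s ->
    [/\ nb i \in F, nb i != s, i \notin nb i & s :\ i \subset nb i].
  move=> si; rewrite /nb; case: pickP => [t /and3P[tF ts st]|H].
    by split=> //; apply: (exchange_notin sF tF).
  by have [t tF ts] := exchange sF si; have := H t; rewrite /= tF ts.
have inj : {in A &, injective nb}.
  move=> i j /(subsetP As) si /(subsetP As) sj E; apply/eqP;
    apply: contraT => ij.
  have [_ _ _ /subsetP/(_ j)] := nbP i si; rewrite !inE eq_sym ij sj E.
  by have [_ _ /negPf-> _] := nbP j sj; move=> /(_ isT).
have sA : s \notin nb @: A.
  apply/imsetP => -[i /(subsetP As) si E].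
  by have [_] := nbP i si; rewrite -E eqxx.
apply: (@leq_trans #|s |: nb @: A|); first by rewrite cardsU1 sA card_in_imset.
apply/subset_leq_card/subsetP => t;
  rewrite !inE => /predU1P[->//|/imsetP[i iA ->]].
by have [tF ts _ st] := nbP i (subsetP As i iA); apply: HQ st.
Qed.

Lemma card_facets_edge s v w : s \in F -> v \in s -> w \in s ->
  (d.-1 <= #|[set t in F | (v \in t) && (w \in t)]|)%N.
Proof.
move=> sF vs ws; apply: leq_trans (_ : #|s :\: [set v; w]| < _)%N.
  rewrite cardsD (card_facet sF).
  have := subset_leq_card (subsetIr s [set v; w]); rewrite cards2; lia.
apply: (card_exchange sF (subsetDl _ _)); first by rewrite inE sF vs ws.
move=> i t; rewrite !inE negb_or -andbA => /and3P[iv iw _] -> _ /subsetP st /=.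
by rewrite !st // !inE eq_sym ?iv ?iw.
Qed.

(** Suppose that the set [T] of the facets counted has fewer than [d - 1]
    elements. Then some nonzero [c] vanishes at the normals of [a] and of
    [T]. The facets through [v] on the positive side of [c] are connected to
    each other without meeting [T], and [a] has a neighbour among them if
    there are any. Along such paths the number of points of [S] cannot get
    past [1], so it stays [0] as in [a]. The same holds on the negative side,
    and a facet at level zero has a neighbour on one of the two sides. So
    every facet through [v] that meets [S] belongs to [T]; but at least [d -
    1] facets contain both [v] and a given point of [S] in [b]. *)
Lemma balinski_link v S a b : a \in F -> v \in a -> [disjoint a & S] ->
  b \in F -> v \in b -> v \notin S -> ~~ [disjoint b & S] ->
  (d.-1 <= #|[set t in F | (v \in t) && (#|t :&: S| == 1%N)]|)%N.
Proof.
move=> aF va aS bF vb vS bS; set T := [set t in F | _]; rewrite leqNgt.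
apply/negP => Td; have vF (s : {set I}) : v \in s ->
  [set v] \subset s by rewrite sub1set.
have a0 : #|a :&: S| = 0%N by apply/eqP; rewrite cards_eq0 setI_eq0.
have step0 s t : adjacent s t -> v \in t -> t \notin T -> #|s :&: S| = 0%N ->
    #|t :&: S| = 0%N.
  move=> st vt; have /andP[/andP[_ tF] _] := st; rewrite inE tF vt /= => t1 s0.
  by have := adjacent_cardI S st; rewrite s0; case: #|_| t1 => [|[]].
(* fewer than d vectors have a nonzero orthogonal vector *)
have [c c0 [ca cT]] : exists2 c : 'rV[R]_d, c != 0 &
    height c a = 0 /\ forall t, t \in T -> height c t = 0.
  pose A := \matrix_(i < #|a |: T|) u (enum_val i).
  have [|c c0 Ac] := @exists_orthogonal _ _ _ A.
    apply: leq_ltn_trans (rank_leq_row _) _; rewrite cardsU1; lia.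
  have HA t : t \in a |: T -> height c t = 0.
    move=> tT; have := Ac (enum_rank_in tT t).
    by rewrite rowK enum_rankK_in.
  by exists c => //; split=> [|t tT]; apply: HA;
    [exact: setU11 | exact: setU1r].
(* a is not a maximum of c1, so its neighbour on the positive side is the
   starting point of a path to s *)
have side c1 s : height c1 a = 0 -> (forall t, t \in T -> height c1 t = 0) ->
    s \in F -> v \in s -> 0 < height c1 s -> #|s :&: S| = 0%N.
  move=> c1a c1T sF vs s0.
  have [i ai /andP[iv ci]] : exists2 i, i \in a & (i \notin [set v])
    && (coef c1 a i < 0).
    apply/exists_inP; apply: contraTT s0 => /exists_inPn H; rewrite -leNgt -c1a.
    apply: (height_le_top aF sF (vF s vs)) => i ai iv.
    by have := H i ai; rewrite iv /= -leNgt.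
  have [t [tF ta at_ vt]] := improve aF ai ci.
  have vt' : v \in t by rewrite -sub1set; apply: subsetD1_face (vF a va) iv at_.
  have t0 : 0 < height c1 t by rewrite -c1a.
  have nT x : 0 < height c1 x -> x \notin T.
    by move=> x0; apply: contraTN x0 => /c1T->; rewrite ltxx.
  have tS : #|t :&: S| = 0%N.
    by apply: (step0 a) => //; [apply: adjacent_exchange at_ | apply: nT].
  pose m := Num.min (height c1 s) (height c1 t).
  have m0 : 0 < m by rewrite lt_min s0 t0.
  have : connect (above [set v] c1 m) t s.
    by apply: connect_above; rewrite ?vF // ge_min lexx ?orbT.
  apply: (connect_ind (P := fun x => #|x :&: S| = 0%N)) => // x y _ x0.
  move=> /and5P[xy _ vy _ my]; apply: step0 xy _ _ x0;
    first by rewrite -sub1set.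
  by apply: nT; apply: lt_le_trans my.
have away s : s \in F -> v \in s -> s \notin T -> #|s :&: S| = 0%N.
  move=> sF vs sT; have [s0|s0|/esym s0] := ltrgtP (height c s) 0.
  - apply: (side (- c)); rewrite ?heightN ?ca ?oppr0 ?oppr_gt0 //.
    by move=> t tT; rewrite heightN cT ?oppr0.
  - exact: (side c).
  have [i si /andP[iv ci]] : exists2 i, i \in s & (i != v) && (coef c s i != 0).
    apply/exists_inP; apply: contraT => /exists_inPn H.
    (* then c is a multiple of pt v, which has height 1 on all facets through
       v *)
    have c1 : c = coef c s v *: p v.
      rewrite {1}(covecK c sF) (bigD1 v) //= big1 ?addr0 // => j /andP[sj jv].
      by have := H j sj; rewrite jv /= negbK => /eqP cj;
        rewrite -[dot _ _]/(coef c s j) cj scale0r.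
    move: s0 c0; rewrite c1 /height dotZl (normal_eq1 sF vs) mulr1 => <-.
    by rewrite scale0r eqxx.
  have [t tF /andP[ts st]] := exchange sF si.
  have vt : v \in t.
    by apply: (subsetP st); rewrite !inE eq_sym iv.
  have t0 : height c t != 0.
    rewrite (height_exchange c sF tF si st) -s0 sub0r oppr_eq0 mulf_neq0 //
      gt_eqF //.
    by rewrite subr_gt0 normal_lt1 // (exchange_notin sF tF).
  have tS : #|t :&: S| = 0%N.
    move: t0; rewrite neq_lt => /orP[t0|t0]; last exact: (side c).
    apply: (side (- c)); rewrite ?heightN ?ca ?oppr0 ?oppr_gt0 //.
    by move=> x xT; rewrite heightN cT ?oppr0.
  by apply: (step0 t) => //; rewrite adjacentC; apply: adjacent_exchange st.
have /pred0Pn[w /andP[wb wS]] := bS.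
move: Td; rewrite ltnNge => /negP; apply.
apply: leq_trans (card_facets_edge bF vb wb) _.
apply/subset_leq_card/subsetP => t; rewrite inE => /and3P[tF vt wt].
apply: contraT => /(away t tF vt)/eqP; rewrite cards_eq0 => /eqP/setP/(_ w).
by rewrite !inE wt (wS : w \in S).
Qed.

Definition edge_in S : rel I := fun v w =>
  [&& v \in S, w \in S & [exists s in F, (v \in s) && (w \in s)]].

Definition connected_set S := forall v w, v \in S -> w \in S ->
  connect (edge_in S) v w.

Lemma edge_in_sym S : connect_sym (edge_in S).
Proof.
apply: sym_connect_sym => v w; rewrite /edge_in andbCA; do 2!congr (_ && _).
by apply: eq_existsb => s; rewrite [in RHS](andbC (w \in s)).
Qed.

Lemma edge_in_facet S s v w : s \in F -> v \in s -> w \in s -> v \in S ->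
  w \in S ->
  edge_in S v w.
Proof.
by move=> sF vs ws vS wS; apply/and3P; split=> //; apply/exists_inP;
  exists s => //; rewrite vs.
Qed.

(** Follow a path of facets that avoids [r]: two neighbours on it share a
    vertex outside [r], since otherwise their common ridge would lie in three
    facets. *)
Lemma connected_minus_facet r : r \in F -> connected_set (vertex_set X :\: r).
Proof.
move=> rF v w /setDP[/vertex_setP[s sF vs] vr] /setDP[/vertex_setP[t tF wt] wr].
set S := vertex_set X :\: r.
have inS x y : y \in F -> x \in y -> x \notin r -> x \in S.
  by move=> yF xy xr; rewrite inE xr; apply/vertex_setP; exists y.
have sr : s != r by apply: contraNneq vr => <-.
have tr : t != r by apply: contraNneq wr => <-.
suff H : forall x, x \in t -> x \notin r -> connect (edge_in S) v x by exact: H.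
refine (connect_ind (P := fun y : {set I} => forall x, x \in y -> x \notin r ->
  connect (edge_in S) v x) _ _ (connect_avoid_facet rF sF tF sr tr)).
  move=> x xs xr; apply: connect1.
  by apply: (@edge_in_facet _ s) => //; apply: inS sF _ _.
move=> a b _ IH /and3P[/andP[/andP[aF bF] ab] ar br] x xb xr.
have [z /setIP[za zb] zr] : exists2 z, z \in a :&: b & z \notin r.
  apply/exists_inP; apply: contraT => /exists_inPn H.
  have abr : a :&: b \subset r by apply/subsetP => z /H; rewrite negbK.
  have ca : #|a :&: b| = d.-1.
    have := cardsID a b; rewrite (eqP ab) (card_facet bF) setIC => <-.
    by rewrite addn1.
  have E := ridge_two_facets rF aF bF abr (subsetIl _ _) (subsetIr _ _) ca ar
    br.
  by move: ab; rewrite E setDv cards0.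
apply: connect_trans (IH z za zr) _; apply: connect1.
by apply: (@edge_in_facet _ b) => //; apply: inS bF _ _.
Qed.

(** Removing [v] from [S] uncovers at least one facet. *)
Definition exposed S v := [exists s in F, s :&: S == [set v]].

Lemma exposed_in S v : exposed S v -> v \in S.
Proof.
by move=> /exists_inP[s _ /eqP sS]; have := set11 v; rewrite -sS inE => /andP[].
Qed.

(** The step from [a] to [b] drops a single vertex, which must be the only
    point of [D] in [a]; by the last hypothesis it is the only point of [S]
    in [a]. *)
Lemma exposed_crossing S (D a b : {set I}) : adjacent a b -> D \subset S ->
  ~~ [disjoint a & D] -> [disjoint b & D] ->
  (forall x y, x \in D -> y \in S -> x \in a -> y \in a -> y \in D) ->
  exists2 z, z \in D & exposed S z.
Proof.
move=> ab DS aD bD H; have /pred0Pn[z /andP[/= za zD]] := aD.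
exists z => //; apply/exists_inP; exists a; first by case/andP: ab => /andP[].
have /cards1P[y ay] : #|a :\: b| == 1%N by rewrite adjacentC in ab;
  case/andP: ab.
have H1 x : x \in D -> x \in a -> x = y.
  move=> xD xa; apply/set1P; rewrite -ay inE xa andbT.
  by apply: contraL xD => xb; rewrite (disjointFr bD xb).
apply/eqP/setP => x; rewrite !inE; apply/andP/eqP => [[xa xS]|->]; last first.
  by split=> //; apply: (subsetP DS).
by rewrite (H1 x (H z x zD xS za xa) xa) -(H1 z zD za).
Qed.

Lemma exists_exposed r S w : r \in F -> [disjoint r & S] ->
  S \subset vertex_set X ->
  w \in S -> exists v, exposed S v.
Proof.
move=> rF rS SX wS; have /vertex_setP[s sF ws] := subsetP SX w wS.
have st : connect (above set0 0 0) s r.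
  by apply: connect_above; rewrite ?sub0set // /height dot0l.
have sS : ~~ [disjoint s & S] by apply/pred0Pn; exists w; rewrite /= ws.
have [a [b [/and5P[ab _ _ _ _] aS bS]]] :=
  connect_exit (P := fun x : {set I} => ~~ [disjoint x & S]) st sS
    (introN negP (fun H => H rS)).
rewrite negbK in bS.
have [z _ ez] := exposed_crossing ab (subxx S) aS bS (fun x y _ yS _ _ => yS).
by exists z.
Qed.

(** Among the exposed vertices [v] and the components [C] of [S :\ v], take a
    pair with [C] largest. If [C] is not all of [S :\ v], a path of facets
    that avoids [v] leads from a facet that meets the rest [D] to [r]; where
    it leaves [D] it yields an exposed vertex [z] of [D]. But [C] together
    with [v] is connected in [S :\ z], which contradicts the choice of [C]. *)
Lemma exists_removable r S : r \in F -> [disjoint r & S] ->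
  S \subset vertex_set X ->
  connected_set S -> (1 < #|S|)%N ->
  exists2 v, exposed S v & connected_set (S :\ v).
Proof.
move=> rF rS SX cS S2.
pose comp v x := [set y in S :\ v | connect (edge_in (S :\ v)) x y].
pose Q := [pred vx : I * I | exposed S vx.1 && (vx.2 \in S :\ vx.1)].
have [v0 [x0 Q0]] : exists v x, Q (v, x).
  have /card_gt0P[w wS] : (0 < #|S|)%N by exact: ltnW.
  have [v ev] := exists_exposed rF rS SX wS; exists v.
  have /card_gt0P[x xS] : (0 < #|S :\ v|)%N.
    by move: S2; rewrite (cardsD1 v) (exposed_in ev).
  by exists x; rewrite /= ev.
have [[v x] /andP[/= ev xS] cmax] :=
  @arg_maxnP _ (v0, x0) Q (fun vx => #|comp vx.1 vx.2|) Q0.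
set C := comp v x in cmax.
have CS : C \subset S :\ v by apply/subsetP => y; rewrite inE => /andP[].
have vS := exposed_in ev.
have clC y z : y \in C -> edge_in (S :\ v) y z -> z \in C.
  rewrite !inE => /andP[/andP[yv yS] xy] yz.
  have /and3P[_ zS _] := yz.
  by move: zS; rewrite !inE => ->; apply: connect_trans xy (connect1 yz).
have [SC|/subsetPn[y yS yC]] := boolP (S :\ v \subset C).
  exists v => // a b /(subsetP SC) + /(subsetP SC).
  rewrite !inE => /andP[_ xa] /andP[_ xb].
  by apply: connect_trans xb; rewrite edge_in_sym.
exfalso; pose D := (S :\ v) :\: C.
have DS : D \subset S by apply: subset_trans (subsetDl _ _) (subsetDl _ _).
have /setD1P[yv yS'] := yS.
have [s [sF ys vs]] : exists s, [/\ s \in F, y \in s & v \notin s].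
  have /vertex_setP[s sF ys] := subsetP SX y yS'.
  have [vs|vs] := boolP (v \in s); last by exists s.
  have [t tF /andP[ts st]] := exchange sF vs; exists t; split=> //.
    by apply: (subsetP st); rewrite !inE yv.
  exact: (exchange_notin sF tF vs ts st).
have vr : v \notin r by apply: contraL vS => vr; rewrite (disjointFr rS).
have sr := connect_avoid_vertex sF rF vs vr.
have sD : ~~ [disjoint s & D].
  by apply/pred0Pn; exists y; rewrite /= ys inE yC.
have rD : ~~ ~~ [disjoint r & D] by rewrite negbK; apply: disjointWr rS.
have [a [b [/and3P[ab va vb] aD bD]]] :=
  connect_exit (P := fun x : {set I} => ~~ [disjoint x & D]) sr sD rD.
rewrite negbK in bD; have aF : a \in F by case/andP: ab => /andP[].
have [g h gD hS ga ha|z zD ez] := exposed_crossing ab DS aD bD.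
  have hv : h != v by apply: contraNneq va => <-.
  have hSv : h \in S :\ v by rewrite !inE hv.
  have /setDP[gS gC] := gD; apply/setDP; split=> //.
  apply: contra gC => hC; apply: (clC _ _ hC).
  exact: edge_in_facet ha ga hSv gS.
have /setDP[/setD1P[zv zS] zC] := zD.
have xz : x \in S :\ z.
  rewrite !inE; have /setD1P[_ ->] := xS; rewrite andbT.
  by apply: contraNneq zC => <-; rewrite inE xS connect0.
have xC : x \in C by rewrite inE xS connect0.
have CSz w : w \in C -> w \in S :\ z.
  move=> wC; have /setD1P[_ wS] := subsetP CS w wC; rewrite !inE wS andbT.
  by apply: contraNneq zC => <-.
have C1 : C \subset comp z x.
  apply/subsetP => w wC; rewrite inE CSz //; move: (wC);
    rewrite inE => /andP[_ xw].
  apply: (connect_ind (P := fun w : I => connect (edge_in (S :\ z)) x w)) xw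
    => //.
  move=> g h xg xg' gh; apply: connect_trans xg' (connect1 _).
  have gC : g \in C by rewrite inE xg andbT; case/and3P: gh.
  have hC := clC _ _ gC gh; case/and3P: gh => _ _ gh.
  by apply/and3P; split; rewrite ?CSz.
(* S is connected, so v is a neighbour of C *)
have vz : v \in comp z x.
  have xvS : connect (edge_in S) x v by apply: cS => //; case/setD1P: xS.
  have vC : v \notin C by apply/negP => /(subsetP CS); rewrite !inE eqxx.
  have [g [h [gh gC hC]]] := connect_exit (P := fun w : I => w \in C) xvS xC vC.
  have hv : h = v.
    apply: contraNeq hC => hv; apply: (clC _ _ gC); case/and3P: gh => gS hS gh.
    apply/and3P; split=> //; last by rewrite !inE hv.
    exact: (subsetP CS g gC).
  rewrite inE !inE eq_sym zv vS /=; move: (subsetP C1 g gC);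
    rewrite inE => /andP[_ xg].
  apply: connect_trans xg (connect1 _); rewrite -hv.
  case/and3P: gh => gS hS gh; apply/and3P; split=> //; first exact: CSz.
  by rewrite hv !inE eq_sym zv.
have := cmax (z, x); rewrite /= ez xz => /(_ isT); rewrite leqNgt => /negP;
  apply.
apply: proper_card; apply/properP; split=> //; exists v => //.
by apply/negP => /(subsetP CS); rewrite !inE eqxx.
Qed.

(** Induction on [#|S|]: a facet through the removed vertex [v] that contains
    exactly one other point of [S] is counted for [S] and no longer for [S :\
    v]. *)
Lemma card_doubly_covered r S k : r \in F -> [disjoint r & S] ->
  S \subset vertex_set X -> connected_set S -> #|S| = k.+1 ->
  (k * d.-1 <= #|[set s in F | 1 < #|s :&: S|]|)%N.
Proof.
move=> rF; elim: k S => [|k IH] S rS SX cS Sk; first by rewrite mul0n.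
have [|v ev cSv] := exists_removable rF rS SX cS; first by rewrite Sk.
have vS := exposed_in ev.
have Sv : #|S :\ v| = k.+1 by move: Sk; rewrite (cardsD1 v) vS => -[].
have vN : v \notin S :\ v by rewrite !inE eqxx.
have SvS := subsetDl S [set v].
have Dv := IH _ (disjointWr SvS rS) (subset_trans SvS SX) cSv Sv.
have /exists_inP[a aF /eqP aS] := ev.
have va : v \in a by have := set11 v; rewrite -aS inE => /andP[].
have aSv : [disjoint a & S :\ v] by rewrite -setI_eq0 setIDA aS setDv.
have [b [bF vb bSv]] : exists b,
  [/\ b \in F, v \in b & ~~ [disjoint b & S :\ v]].
  have /card_gt0P[w /setD1P[wv wS]] : (0 < #|S :\ v|)%N by rewrite Sv.
  have [x [y [/and3P[xS yS /exists_inP[b bF /andP[xb yb]]] /eqP xv yv]]] :=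
    connect_exit (P := pred1 v) (cS _ _ vS wS) (eqxx v) wv.
  exists b; rewrite -xv; split=> //; apply/pred0Pn; exists y.
  by rewrite /= yb !inE xv yv.
have := balinski_link aF va aSv bF vb vN bSv => Lv.
apply: leq_trans (leq_add Lv Dv) _.
set A := [set t in F | _ && _]; set B := [set s in F | _].
have cS1 t : #|t :&: S| = ((v \in t) + #|t :&: (S :\ v)|)%N.
  by rewrite (cardsD1 v) inE vS andbT setIDA.
rewrite -cardsUI (_ : A :&: B = set0); last first.
  apply/setP => t; rewrite !inE; case: (t \in F) => //=.
  by apply/negP => /andP[/andP[_ /eqP->]].
rewrite cards0 addn0; apply/subset_leq_card/subsetP => t; rewrite !inE cS1.
move=> /orP[/and3P[-> -> /eqP->]//|/andP[-> /=] S1].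
exact: leq_trans S1 (leq_addl _ _).
Qed.

(** Besides the facets that contain two vertices outside [r], there are [r]
    itself and its [d] neighbours, which contain at most one. *)
Theorem facets_lower_bound : (0 < d)%N ->
  ((#|vertex_set X| - d.+1) * d.-1 + d.+1 <= #|F|)%N.
Proof.
move=> d0; have nd := card_vertex_set X d0; have [r rF] := facets_neq0 X.
pose S := vertex_set X :\: r.
have rX : r \subset vertex_set X.
  by apply/subsetP => j jr; apply/vertex_setP; exists r.
have rS : [disjoint r & S] by rewrite -setI_eq0 setIDA setDIl setDv set0I.
have SX : S \subset vertex_set X := subsetDl _ _.
have SS : #|S| = (#|vertex_set X| - d.+1).+1.
  by rewrite cardsD (setIidPr rX) (card_facet rF); lia.
have HD := card_doubly_covered rF rS SX (connected_minus_facet rF) SS.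
set D := [set s in F | _] in HD.
have rS0 : #|r :&: S| = 0%N by apply/eqP; rewrite cards_eq0 setI_eq0.
suff H : (d.+1 <= #|F :\: D|)%N.
  apply: leq_trans (leq_add HD H) _; rewrite -(cardsID D F) leq_add //.
  by apply/subset_leq_card/subsetP => s; rewrite !inE => /andP[->].
rewrite -[X in (X < _)%N](card_facet rF).
have rD : r \in F :\: D by rewrite !inE rF andbT rS0.
apply: (card_exchange rF (subxx r) rD) => i t ir tF tr rt.
rewrite !inE tF andbT -leqNgt.
by have := adjacent_cardI S (adjacent_exchange rF tF tr rt); rewrite rS0.
Qed.

End lower_bound.

From mathcomp Require Import finmap.
From mathcomp Require Import all_classical all_reals all_analysis.
From mathcomp Require Import measurable_realfun.

Import numFieldNormedType.Exports.

Local Open Scope classical_set_scope.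

(** * Lebesgue measure of cubes *)

(** Rectangles of two exhausting sequences, enumerated by an encoding of
    pairs of indices. *)
Lemma sigma_finite_prod d1 d2 (T1 : measurableType d1) (T2 : measurableType d2)
    (R : realType) (m1 : {sigma_finite_measure set T1 -> \bar R})
    (m2 : {sigma_finite_measure set T2 -> \bar R}) :
  sigma_finite setT (m1 \x m2)%E.
Proof.
have [F TF Ffin] := sigma_finiteT m1; have [G TG Gfin] := sigma_finiteT m2.
pose ij k := odflt (0, 0)%N (choice.unpickle k).
exists (fun k => F (ij k).1 `*` G (ij k).2).
  apply/esym/seteqP; split=> // -[x y] _.
  have [i _ Fx] : (\bigcup_i F i) x by rewrite -TF.
  have [j _ Gy] : (\bigcup_i G i) y by rewrite -TG.
  by exists (choice.pickle (i, j)) => //=; rewrite /ij choice.pickleK.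
move=> k; have [mF Fk] := Ffin (ij k).1; have [mG Gk] := Gfin (ij k).2.
split; first exact: measurableX.
by rewrite product_measure1E // lte_mul_pinfty // ge0_fin_numE.
Qed.

Lemma prodR_lebesgue_measure (R : realType) (d : nat) :
  exists mu : {sigma_finite_measure set (prodR R d) -> \bar R},
    @prodR_lebesgue R d = mu.
Proof.
elim: d => [|d [mu IH]] /=.
  by exists (@dirac _ unit tt R).
rewrite IH; pose nu := (@lebesgue_measure R \x mu)%E.
pose sf := Measure_isSigmaFinite.Build _ _ _ nu (sigma_finite_prod _ _).
pose mu' : {sigma_finite_measure set (prodR R d.+1) -> \bar R} :=
  HB.pack_for {sigma_finite_measure set (prodR R d.+1) -> \bar R} nu sf.
by exists mu'.
Qed.

Section finite_unions.
Context {R : realType} {disp : measure_display} {T : measurableType disp}.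
Variable mu : {measure set T -> \bar R}.
Context {J : eqType}.
Implicit Types (r : seq J) (B : J -> set T) (e : R).

Lemma measure_le_cover r B e A : measurable A ->
  (forall j, j \in r -> measurable (B j) /\ mu (B j) = e%:E) ->
  (forall x, A x -> exists2 j, j \in r & B j x) -> (mu A <= (e *+ size r)%:E)%E.
Proof.
elim: r A => [|j r IH] A mA HB cov.
  by rewrite (_ : A = set0) ?measure0 //; apply/seteqP; split=> // x /cov[].
have [mj ej] := HB j (mem_head _ _).
have mAj := measurableD mA mj.
apply: (@le_trans _ _ (mu (B j `|` (A `\` B j)))).
  apply: le_measure; rewrite ?inE //; first exact: measurableU.
  by move=> x Ax; have [?|?] := pselect (B j x); [left|right].
have le2 : (mu (B j `|` (A `\` B j)) <= mu (B j) + mu (A `\` B j))%E.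
  exact: measureU2.
apply: (le_trans le2).
rewrite ej mulrS EFinD leeD2l // IH // => [i ir|x [Ax Bx]].
  by apply: HB; rewrite inE ir orbT.
by have [i] := cov x Ax; rewrite inE => /predU1P[->//|]; exists i.
Qed.

Lemma measure_ge_packing r B e A : measurable A -> uniq r ->
  (forall j, j \in r -> measurable (B j) /\ mu (B j) = e%:E) ->
  (forall i j x, i \in r -> j \in r -> B i x -> B j x -> i = j) ->
  (forall j x, j \in r -> B j x -> A x) -> ((e *+ size r)%:E <= mu A)%E.
Proof.
elim: r A => [|j r IH] A mA; first by rewrite mulr0n.
move=> /= /andP[jr ur] HB tB BA.
have [mj ej] := HB j (mem_head _ _).
have mAj := measurableD mA mj.
have -> : A = B j `|` (A `\` B j).
  apply/seteqP; split=> [x Ax|x [/BA|[]//]]; last by apply; rewrite mem_head.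
  by have [?|?] := pselect (B j x); [left|right].
have -> : mu (B j `|` (A `\` B j)) = (mu (B j) + mu (A `\` B j))%E.
  by apply: measureU => //; apply/seteqP; split=> // x [? []].
rewrite ej mulrS EFinD leeD2l // IH // => [i ir|i k x ir kr|i x ir Bi].
- by apply: HB; rewrite inE ir orbT.
- by apply: tB; rewrite inE ?ir ?kr orbT.
split; first by apply: BA Bi; rewrite inE ir orbT.
move=> Bj; have ij : i = j by apply: (tB i j x); rewrite ?inE ?ir ?eqxx ?orbT.
by move: jr; rewrite -ij ir.
Qed.

End finite_unions.

Section boxes.
Context {R : realType}.

(** Half-open, so that the translates along a lattice are disjoint. *)
Definition box d (a : 'rV[R]_d) (e : R) : set 'rV[R]_d :=
  [set x | forall i, a 0 i <= x 0 i < a 0 i + e].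

Lemma prodR_rV_head d (x : prodR R d.+1) : prodR_rV x 0 ord0 = x.1.
Proof.
have <- : @lshift 1 d 0 = ord0 by apply/val_inj.
by apply: etrans (row_mxEl _ _ _ _) _; rewrite mxE.
Qed.

Lemma prodR_rV_tail d (x : prodR R d.+1) (j : 'I_d) :
  prodR_rV x 0 (lift ord0 j) = prodR_rV x.2 0 j.
Proof. by rewrite -rshift1; apply: row_mxEr. Qed.

Lemma measurable_coord d i : measurable_fun setT (fun x => @prodR_rV R d x 0 i).
Proof.
elim: d i => [|d IH] i; first by case: i.
case: (unliftP ord0 i) => [j|] ->.
  rewrite (_ : (fun _ => _) = (fun x => prodR_rV x 0 j) \o snd).
    by apply: measurableT_comp; [exact: IH|exact: measurable_snd].
  by apply/funext => x; apply: prodR_rV_tail.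
rewrite (_ : (fun _ => _) = fst); first exact: measurable_fst.
by apply/funext => x; apply: prodR_rV_head.
Qed.

Lemma vol_box d (a : 'rV[R]_d) e : 0 <= e ->
  measurable (@prodR_rV R d @^-1` box a e) /\ vol (box a e) = (e ^+ d)%:E.
Proof.
move=> e0; rewrite /vol; elim: d a => [|d IH] a.
  have -> : @prodR_rV R 0 @^-1` box a e = setT by apply/seteqP;
    split=> // x _ [].
  by split=> //=; rewrite diracE in_setT.
pose a' := \row_j a 0 (lift ord0 j); have [mb vb] := IH a'.
have -> : @prodR_rV R d.+1 @^-1` box a e =
    `[a 0 ord0, a 0 ord0 + e[%classic `*` (@prodR_rV R d @^-1` box a' e).
  apply/seteqP; split=> [x Hx|x [/= + Hx] i].
    split=> [|i] /=; first by rewrite in_itv /= -prodR_rV_head; apply: Hx.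
    by have := Hx (lift ord0 i); rewrite prodR_rV_tail mxE.
  rewrite in_itv /= => Hx0; case: (unliftP ord0 i) => [j|] ->.
    by have := Hx j; rewrite prodR_rV_tail mxE.
  by rewrite prodR_rV_head.
have mi : measurable (`[a 0 ord0,
  a 0 ord0 + e[%classic : set (measurableTypeR R)).
  exact: measurable_itv.
split; first exact: measurableX.
have [mu muE] := prodR_lebesgue_measure R d.
rewrite /= muE in vb *; rewrite product_measure1E // vb.
rewrite exprS EFinM; congr (_ * _)%E.
apply: (etrans (lebesgue_measure_itv _)); rewrite /= lte_fin; case: ltP => [_|].
  by rewrite -EFinB addrC addKr.
by rewrite gerDl => e0'; congr _%:E; apply/eqP; rewrite eq_le e0 e0'.
Qed.

End boxes.

(** * The volume is the number of facets, up to a factorial *)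

Section limit.
Context {R : archiRealFieldType}.

Lemma bernoulli (x : R) d : 0 <= x <= 1 -> 1 - d%:R * x <= (1 - x) ^+ d.
Proof.
move=> /andP[x0 x1]; elim: d => [|d IH]; first by rewrite mul0r subr0 expr0.
rewrite exprS; apply: (@le_trans _ _ ((1 - x) * (1 - d%:R * x))); last first.
  by rewrite ler_wpM2l // subr_ge0.
have : 0 <= d%:R * x * x by rewrite !mulr_ge0.
by rewrite -natr1; lra.
Qed.

(** By Bernoulli's inequality, [(q / (q + D)) ^ d] tends to [1]. *)
Lemma le_of_scaled_le (a b : R) (d D : nat) : 0 <= a ->
  (forall q : nat, (0 < q)%N -> a * q%:R ^+ d <= b * (q + D)%:R ^+ d) -> a <= b.
Proof.
move=> a0 H; rewrite leNgt; apply/negP => ba.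
have ab : 0 < a - b by rewrite subr_gt0.
pose y := a * d%:R * D%:R / (a - b).
have y0 : 0 <= y by apply: divr_ge0; [rewrite !mulr_ge0|exact: ltW].
pose q := Num.bound y.
have yq : y < q%:R := archi_boundP y0.
have q0 : (0 < q)%N by rewrite -(ltr0n R); apply: le_lt_trans yq.
have qD0 : 0 < (q + D)%:R :> R by rewrite ltr0n addn_gt0 q0.
have qD1 : (q + D)%:R != 0 :> R by rewrite gt_eqF.
pose x : R := D%:R / (q + D)%:R.
have x01 : 0 <= x <= 1.
  by rewrite divr_ge0 ?ler0n //= ler_pdivrMr // mul1r ler_nat leq_addl.
have xE : 1 - x = q%:R / (q + D)%:R.
  by apply: (mulIf qD1); rewrite mulrBl mul1r !divfK // natrD addrK.
have le1 : a * (1 - x) ^+ d <= b.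
  by rewrite xE expr_div_n mulrA ler_pdivrMr ?exprn_gt0 // H.
have := le_trans (ler_wpM2l a0 (bernoulli d x01)) le1.
apply/negP; rewrite -ltNge.
suff : a * d%:R * x < a - b by lra.
rewrite /x mulrA ltr_pdivrMr // -ltr_pdivrMl // mulrC.
by apply: lt_le_trans yq _; rewrite ler_nat leq_addr.
Qed.

End limit.

Lemma fact_bin_bounds (d M : nat) :
  (M.+1 ^ d <= d`! * 'C(d + M, d) <= (d + M) ^ d)%N.
Proof.
rewrite mulnC bin_ffact ffact_prod.
have -> : (M.+1 ^ d = \prod_(i < d) M.+1)%N by rewrite prod_nat_const card_ord.
have -> : ((d + M) ^ d = \prod_(i < d) (d + M))%N.
  by rewrite prod_nat_const card_ord.
by apply/andP; split; apply: leq_prod => i _;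
  [have := ltn_ord i; lia|exact: leq_subr].
Qed.

Section volume.
Context {R : realType} {d : nat} {I : finType}.
Variable X : facet_system R d I.
Hypothesis d_gt0 : (0 < d)%N.
Hypothesis pt_int : forall s i, s \in facets X -> i \in s -> lattice (pt X i).
Hypothesis coef_int : forall s i z, s \in facets X -> i \in s -> lattice z ->
  coef X z s i \is a Num.int.

Local Notation F := (facets X).
Local Notation u := (normal X).
Local Notation p := (pt X).
Local Notation coef := (coef X).

Definition facet_body : set 'rV[R]_d :=
  [set x | forall s, s \in F -> dot x (u s) <= 1].

Lemma measurable_facet_body : measurable (@prodR_rV R d @^-1` facet_body).
Proof.
rewrite (_ : _ @^-1` _ = \bigcap_(s in [set` F])
    [set x | dot (prodR_rV x) (u s) <= 1]); last first.
  by apply/seteqP; split=> x H s; [move=> sF; apply: H|apply: H].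
apply: fin_bigcap_measurable; first exact: finite_finset.
move=> s _; rewrite -[X in measurable X]setTI.
apply: measurable_fun_le => //; apply: measurable_sum => i;
  apply: measurable_funM; last exact: measurable_cst.
exact: measurable_coord.
Qed.

Lemma exists_box_bound : exists C : nat, forall s (y : 'rV[R]_d), s \in F ->
  (forall i, 0 <= y 0 i <= 1) -> `|dot y (u s)| <= C%:R.
Proof.
pose B s := \sum_i `|u s 0 i|; pose T := \sum_(s in F) B s.
have B0 s : 0 <= B s by apply: sumr_ge0.
exists (Num.bound T) => s y sF y01.
apply: (@le_trans _ _ T); last by apply/ltW/archi_boundP/sumr_ge0.
apply: (@le_trans _ _ (B s)); last first.
  by rewrite /T (bigD1 s) //= lerDl sumr_ge0.
apply: le_trans (ler_norm_sum _ _ _) _; apply: ler_sum => i _.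
have /andP[y0 y1] := y01 i.
by rewrite normrM (ger0_norm y0) ler_piMl.
Qed.

Section facet_points.
Variable i0 : I.
Implicit Types (s : {set I}) (a : 'I_d -> R) (x z : 'rV[R]_d).

(** The point of the cone over the facet [s] with coordinates [a], in the
    order in which [enum s] lists the vertices; [i0] is the default value of
    [nth]. *)
Definition cone_pt (s : {set I}) (a : 'I_d -> R) : 'rV[R]_d :=
  \sum_(j < d) a j *: p (nth i0 (enum s) j).

Lemma sum_facet (V : nmodType) (G : I -> V) (s : {set I}) : s \in F ->
  \sum_(i in s) G i = \sum_(j < d) G (nth i0 (enum s) j).
Proof.
by move=> sF; rewrite -big_enum (big_nth i0) -cardE (card_facet sF) big_mkord.
Qed.

Lemma nth_enum_in s (j : 'I_d) : s \in F -> nth i0 (enum s) j \in s.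
Proof. by move=> sF; rewrite -mem_enum mem_nth // -cardE (card_facet sF). Qed.

Lemma coef_cone_pt s a (j : 'I_d) : s \in F ->
  coef (cone_pt s a) s (nth i0 (enum s) j) = a j.
Proof.
move=> sF; rewrite /coef dot_suml (bigD1 j) //= dotZl covec_pt ?nth_enum_in //.
rewrite eqxx mulr1 big1 ?addr0 // => k kj.
rewrite dotZl covec_pt ?nth_enum_in // nth_uniq ?enum_uniq -?cardE
  ?(card_facet sF) //.
by rewrite val_eqE (negbTE kj) mulr0.
Qed.

Lemma coef_cone_pt_in s a i : s \in F -> i \in s ->
  exists j, coef (cone_pt s a) s i = a j.
Proof.
move=> sF si; have lt_id : (index i (enum s) < d)%N.
  by rewrite -(card_facet sF) cardE index_mem mem_enum.
exists (Ordinal lt_id); rewrite -(coef_cone_pt _ (Ordinal lt_id) sF) /=.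
by rewrite nth_index // mem_enum.
Qed.

Lemma cone_pt_coef s x : s \in F ->
  x = cone_pt s (fun j => coef x s (nth i0 (enum s) j)).
Proof. by move=> sF; rewrite {1}(covecK x sF) sum_facet. Qed.

Lemma dot_cone_pt s a : s \in F -> dot (cone_pt s a) (u s) = \sum_(j < d) a j.
Proof.
move=> sF; rewrite dot_suml; apply: eq_bigr => j _.
by rewrite dotZl normal_eq1 ?mulr1 // nth_enum_in.
Qed.

Lemma cone_pt_int s a : s \in F -> (forall j, a j \is a Num.int) ->
  lattice (cone_pt s a).
Proof.
move=> sF ai; apply/mxOverP => k l; rewrite summxE rpred_sum // => j _.
by have /mxOverP pj := pt_int sF (nth_enum_in j sF); rewrite mxE rpredM.
Qed.

(** A point with positive coordinates lies in the interior of the cone over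
    [s]: as an objective it has its only maximum at [normal s]. *)
Lemma cone_pt_inj s t a b : s \in F -> t \in F ->
  (forall j, 0 < a j) -> (forall j, 0 < b j) -> cone_pt s a = cone_pt t b ->
  s = t /\ a =1 b.
Proof.
have coef_gt0 s' a' : s' \in F -> (forall j, 0 < a' j) ->
    forall i, i \in s' -> 0 < coef (cone_pt s' a') s' i.
  by move=> s'F a'0 i si; have [j ->] := coef_cone_pt_in a' s'F si.
move=> sF tF a0 b0 E; have st : s = t.
  apply/esym; apply: (top_unique (c := cone_pt s a) sF tF (finset.sub0set s)
    (finset.sub0set t)) => [i si _|]; first exact: coef_gt0.
  rewrite E; apply: (height_le_top tF sF (finset.sub0set s)) => i ti _.
  exact/ltW/coef_gt0.
by split=> // j; rewrite -(coef_cone_pt a j sF) E st coef_cone_pt // -st.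
Qed.

End facet_points.

Definition lattice_box (N : nat) (z : 'rV[R]_d) : set 'rV[R]_d :=
  box (N%:R^-1 *: z) N%:R^-1.

Lemma lattice_boxP N z x : (0 < N)%N ->
  lattice_box N z x <-> forall i, 0 <= (N%:R *: x - z) 0 i < 1.
Proof.
move=> N0; have N0' : 0 < N%:R :> R by rewrite ltr0n.
have E i : (N%:R^-1 *: z) 0 i <= x 0 i < (N%:R^-1 *: z) 0 i + N%:R^-1 =
    (0 <= (N%:R *: x - z) 0 i < 1).
  rewrite !mxE -[X in _ < _ + X]mulr1 -mulrDr ler_pdivrMl // ltr_pdivlMl //.
  by rewrite subr_ge0 ltrBlDl.
by split=> H i; have := H i; rewrite E.
Qed.

Lemma lattice_box_disjoint N z z' x : (0 < N)%N -> lattice z -> lattice z' ->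
  lattice_box N z x -> lattice_box N z' x -> z = z'.
Proof.
move=> N0 /mxOverP lz /mxOverP lz' /(lattice_boxP _ _ N0) H
  /(lattice_boxP _ _ N0) H'.
apply/rowP => i; move: (H i) (H' i) (lz 0 i) (lz' 0 i).
rewrite !mxE => zi zi' /intrP[m mz] /intrP[m' mz']; rewrite mz mz' in zi zi' *.
have lt1 : (m - m' < 1)%R.
  by rewrite -(ltr_int R) intrB; lra.
have lt2 : (m' - m < 1)%R.
  by rewrite -(ltr_int R) intrB; lra.
by have -> : m = m' by lia.
Qed.

Lemma exists_lattice_box N x : (0 < N)%N ->
  exists2 z, lattice z & lattice_box N z x.
Proof.
move=> N0; exists (\row_i (Num.floor (N%:R * x 0 i))%:~R).
  by apply/mxOverP => i j; rewrite mxE.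
apply/(lattice_boxP _ _ N0) => i; rewrite !mxE.
by have := floor_itv (N%:R * x 0 i); rewrite intrD; lra.
Qed.

Definition simplex_tuples K : {set d.-tuple 'I_K.+1} :=
  [set t : d.-tuple 'I_K.+1 | (\sum_(i <- t) i <= K)%N]%SET.

(** With the shift [o = 1] the point lies in the interior of the cone, which
    makes the representation unique; with [o = 0] all lattice points of the
    closed cone are reached. *)
Definition coord_of (o : nat) K (t : d.-tuple 'I_K.+1) (j : 'I_d) : R :=
  (tnth t j + o)%:R.

Lemma size_simplex_points K :
  size (enum (finset.setX F (simplex_tuples K))) = (#|F| * 'C(d + K, d))%N.
Proof. by rewrite -cardE cardsX card_partial_ord_partitions. Qed.

Lemma sum_coord_of o K (t : d.-tuple 'I_K.+1) :
  \sum_(j < d) coord_of o t j = (\sum_(i <- t) i + d * o)%:R.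
Proof.
rewrite -natr_sum big_split /= sum_nat_const card_ord; congr (_ + _)%:R.
by rewrite big_tuple.
Qed.

Local Notation flat := (@prodR_rV R d).

(** Round [N x] down to a lattice point [y] for [x] in the body: the normals
    change by at most [C], so [y] is a point with sum of coordinates at most
    [N + C] in the cone that contains it. *)
Lemma vol_upper (i0 : I) C N : (0 < N)%N ->
  (forall s (y : 'rV[R]_d), s \in F ->
    (forall i, 0 <= y 0 i <= 1) -> `|dot y (u s)| <= C%:R) ->
  (vol facet_body <= (N%:R^-1 ^+ d *+ (#|F| * 'C(d + (N + C), d)))%:E)%E.
Proof.
move=> N0 HC; set K := (N + C)%N; rewrite -size_simplex_points /vol.
have [nu nuE] := prodR_lebesgue_measure R d; rewrite nuE.
pose z (st : {set I} * d.-tuple 'I_K.+1) := cone_pt i0 st.1 (coord_of 0 st.2).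
apply: (@measure_le_cover _ _ _ nu _ _
  (fun st => flat @^-1` lattice_box N (z st))).
- exact: measurable_facet_body.
- move=> st _; have N0' : 0 <= N%:R^-1 :> R by rewrite invr_ge0.
  have [mb vb] := vol_box (N%:R^-1 *: z st) N0'.
  by split=> //; rewrite -vb /vol nuE.
move=> x' /= Hx; set x := prodR_rV x' in Hx *.
have [y ly yx] := exists_lattice_box x N0.
have [s sF cs] := exists_cone X y.
have cN (j : 'I_d) : exists m : nat, coef y s (nth i0 (enum s) j) = m%:R.
  have sj := nth_enum_in i0 j sF; apply/natrP.
  by rewrite natrEint coef_int //= cs.
have [m Hm] := choice cN.
have sumK : (\sum_(j < d) m j <= K)%N.
  rewrite -(ler_nat R) natr_sum (eq_bigr _ (fun j _ => esym (Hm j))).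
  rewrite -(dot_cone_pt i0 _ sF) -(cone_pt_coef i0 y sF) /K natrD.
  have -> : y = N%:R *: x - (N%:R *: x - y) by rewrite opprB addrC subrK.
  rewrite dotBl dotZl lerD //.
    by rewrite ler_piMr // Hx.
  apply: le_trans (HC s (N%:R *: x - y) sF _).
    by rewrite -normrN ler_norm.
  by move=> i; have /andP[-> /ltW ->] := (lattice_boxP _ _ N0).1 yx i.
have mK j : (m j < K.+1)%N.
  by rewrite ltnS; apply: leq_trans sumK; rewrite (bigD1 j) //= leq_addr.
pose t := [tuple (inord (m j) : 'I_K.+1) | j < d].
exists (s, t).
  rewrite mem_enum finset.in_setX sF /= finset.inE big_tuple.
  rewrite (eq_bigr m) // => j _; by rewrite tnth_mktuple inordK.
suff -> : z (s, t) = y by [].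
rewrite [RHS](cone_pt_coef i0 y sF); apply: eq_bigr => j _; congr (_ *: _).
by rewrite Hm /coord_of tnth_mktuple addn0 inordK.
Qed.

(** The points have sum of coordinates at most [M + d] because of the shift
    by [1], and the normals vary by at most [C] on the unit cube, so the
    cubes stay in the body dilated by [M + d + C]. *)
Lemma vol_lower (i0 : I) C M :
  (forall s (y : 'rV[R]_d), s \in F ->
    (forall i, 0 <= y 0 i <= 1) -> `|dot y (u s)| <= C%:R) ->
  (((M + d + C)%:R^-1 ^+ d *+ (#|F| * 'C(d + M, d)))%:E <= vol facet_body)%E.
Proof.
move=> HC; set N := (M + d + C)%N; rewrite -size_simplex_points /vol.
have N0 : (0 < N)%N by rewrite /N; lia.
have [nu nuE] := prodR_lebesgue_measure R d; rewrite nuE.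
pose z (st : {set I} * d.-tuple 'I_M.+1) := cone_pt i0 st.1 (coord_of 1 st.2).
have co0 K (t : d.-tuple 'I_K.+1) j : 0 < coord_of 1 t j.
  by rewrite ltr0n addn1.
have zP st : st \in enum (finset.setX F (simplex_tuples M)) ->
    [/\ st.1 \in F, lattice (z st) & (\sum_(i <- st.2) i <= M)%N].
  case: st => s t; rewrite mem_enum finset.in_setX finset.inE => /andP[sF tM].
  split=> //.
  by apply: cone_pt_int => // j; apply: rpred_nat.
apply: (@measure_ge_packing _ _ _ nu _ _
  (fun st => flat @^-1` lattice_box N (z st))).
- exact: measurable_facet_body.
- exact: enum_uniq.
- move=> st _; have N0' : 0 <= N%:R^-1 :> R by rewrite invr_ge0.
  have [mb vb] := vol_box (N%:R^-1 *: z st) N0'.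
  by split=> //; rewrite -vb /vol nuE.
- move=> [s t] [s' t'] x /zP[/= sF lz _] /zP[/= s'F lz' _] /= xs xt.
  have E := lattice_box_disjoint N0 lz lz' xs xt.
  have [-> tt'] := cone_pt_inj sF s'F (co0 _ t) (co0 _ t') E.
  congr (_, _); apply: eq_from_tnth => j; apply/val_inj => /=.
  by have /eqP := tt' j; rewrite eqr_nat eqn_add2r => /eqP.
move=> st x' /zP[sF _ tM] /=; set x := prodR_rV x' => xb s s'F.
have N0' : 0 < N%:R :> R by rewrite ltr0n.
rewrite -(ler_pM2l N0') mulr1 -dotZl.
have -> : N%:R *: x = z st + (N%:R *: x - z st) by rewrite addrC subrK.
rewrite dotDl [leRHS](_ : _ = (M + d)%:R + C%:R); last by rewrite -natrD.
apply: lerD.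
  have : height X (z st) s <= height X (z st) st.1.
    apply: (height_le_top sF s'F (finset.sub0set s)) => i si _.
    have [j ->] := coef_cone_pt_in i0 (coord_of 1 st.2) sF si.
    exact/ltW/co0.
  move=> /le_trans; apply; rewrite [X in X <= _]dot_cone_pt // sum_coord_of.
  by rewrite ler_nat muln1 leq_add2r.
apply: (le_trans (ler_norm _)); apply: HC => // i.
by have /andP[-> /ltW ->] := (lattice_boxP _ _ N0).1 xb i.
Qed.

(** As [d! * 'C(d + M, d)] lies between [(M + 1) ^ d] and [(d + M) ^ d], the
    upper and the lower estimates have the same limit. *)
Theorem vol_facet_body : ((d`!)%:R%:E * vol facet_body = (#|F|)%:R%:E)%E.
Proof.
have [i0 _] : exists i0 : I, i0 \in [set: I]%SET.
  have [s sF] := facets_neq0 X; apply/set0Pn; rewrite -card_gt0 cardsT.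
  by apply: leq_trans (max_card s); rewrite (card_facet sF).
have [C HC] := exists_box_bound.
have up N := @vol_upper i0 C N.+1 isT HC.
have lo M := vol_lower i0 M HC.
have vfin : vol facet_body \is a fin_num.
  rewrite fin_numE; apply/andP; split.
    by rewrite gt_eqF // (lt_le_trans (ltNyr _) (lo 0)).
  by rewrite lt_eqF // (le_lt_trans (up 0) (ltry _)).
move: (vol facet_body) vfin up lo => [v| |] // _ up lo.
rewrite -EFinM; congr _%:E.
have v0 : 0 <= v.
  by have := lo 0; rewrite lee_fin; apply: le_trans;
    rewrite mulrn_wge0 // exprn_ge0 // invr_ge0.
apply/eqP; rewrite eq_le; apply/andP; split.
  apply: (@le_of_scaled_le _ _ _ d (d + C)); first by rewrite mulr_ge0.
  move=> q q0; have := up q.-1; rewrite prednK // lee_fin.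
  rewrite -mulr_natr exprVn ler_pdivlMl ?exprn_gt0 ?ltr0n // => le.
  rewrite -mulrA (mulrC v); apply: le_trans (ler_wpM2l _ le) _ => //.
  rewrite -!natrX -!natrM ler_nat mulnCA leq_mul2l; apply/orP; right.
  have /andP[_] := fact_bin_bounds d (q + C).
  by rewrite (_ : d + (q + C) = q + (d + C))%N //; lia.
apply: (@le_of_scaled_le _ _ _ d (d + C)) => // q q0; have := lo q.-1.
have N0 : 0 < (q.-1 + d + C)%:R ^+ d :> R by rewrite exprn_gt0 // ltr0n; lia.
rewrite lee_fin -mulr_natr exprVn ler_pdivrMl // => le.
apply: (@le_trans _ _ (d`!%:R * ((q.-1 + d + C)%:R ^+ d * v))); last first.
  rewrite -mulrA ler_wpM2l // mulrC ler_wpM2l // lerXn2r ?nnegrE //.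
  by rewrite ler_nat; lia.
apply: le_trans (ler_wpM2l _ le) => //.
rewrite -!natrX -!natrM ler_nat mulnCA leq_mul2l; apply/orP; right.
by have /andP[+ _] := fact_bin_bounds d q.-1; rewrite prednK.
Qed.

End volume.

(** * Convex hulls and intersections of half-spaces *)

Section topology.
Context {R : realType} {d : nat}.
Implicit Types (x y w : 'rV[R]_d) (A : set 'rV[R]_d).

Definition l1norm w := \sum_i `|w 0 i|.

Lemma l1norm_ge0 w : 0 <= l1norm w.
Proof. exact: sumr_ge0. Qed.

Lemma dot_ball x y w (e : R) : ball x e y -> `|dot y w - dot x w|
  <= e * l1norm w.
Proof.
move=> xy; rewrite -dotBl mulr_sumr (le_trans (ler_norm_sum _ _ _)) //.
apply: ler_sum => i _; rewrite normrM ler_wpM2r // !mxE distrC.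
exact/ltW/(xy.2 0 i).
Qed.

Lemma interior_ray A x w : interior A x -> exists2 e : R,
  0 < e & A (x + e *: w).
Proof.
move=> /nbhs_ballP[e /= e0 xA]; pose t := e / (l1norm w + 1).
have w1 : 0 < l1norm w + 1 by rewrite ltr_wpDl ?l1norm_ge0.
exists t; first exact: divr_gt0.
apply: xA; split=> // i j;
  rewrite ord1 /ball /= !mxE opprD addrA subrr sub0r normrN.
rewrite normrM gtr0_norm ?divr_gt0 // mulrAC ltr_pdivrMr // ltr_pM2l //.
apply: le_lt_trans (_ : l1norm w < _); last by rewrite ltrDl.
by rewrite /l1norm (bigD1 j) //= lerDl sumr_ge0.
Qed.

Context {J : finType}.
Variables (D : {set J}) (u : J -> 'rV[R]_d).

Let body := [set x | forall s, s \in D -> dot x (u s) <= 1].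

Let l1D := \sum_(s in D) l1norm (u s).

Let l1norm_le s : s \in D -> l1norm (u s) <= l1D.
Proof.
by move=> sD; rewrite /l1D (bigD1 s) //= lerDl sumr_ge0 // => *;
  apply: l1norm_ge0.
Qed.

Lemma halfspaces_closure : closure body `<=` body.
Proof.
move=> x xB s sD; rewrite leNgt; apply/negP => xs.
have [e e0 He] := small_eps [:: (dot x (u s) - 1, - l1norm (u s))].
have {}He := He _ (mem_head _ _); rewrite /= subr_gt0 in He.
have [y [yB /(dot_ball (u s)) xy]] := xB _ (nbhsx_ballx x e e0).
have := yB s sD; have := He xs; move: xy; rewrite ler_norml; lra.
Qed.

Lemma halfspaces_interior x : (forall s, s \in D -> dot x (u s) < 1) ->
  interior body x.
Proof.
move=> xD; have [e e0 He] :=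
  small_eps [seq (1 - dot x (u s), - l1norm (u s)) | s <- enum D].
apply/nbhs_ballP; exists e => // y xy s sD.
have := He (1 - dot x (u s), - l1norm (u s)); rewrite /= subr_gt0.
have -> : (1 - dot x (u s), - l1norm (u s)) \in
    [seq (1 - dot x (u s), - l1norm (u s)) | s <- enum D].
  by apply/mapP; exists s; rewrite ?mem_enum.
move=> /(_ isT (xD s sD)); have := dot_ball (u s) xy; rewrite ler_norml; lra.
Qed.

End topology.

Section hulls.
Context {R : realType} {d : nat}.
Implicit Types (x y w : 'rV[R]_d) (A : set 'rV[R]_d).

Lemma convex_setP A : @convex_set R 'rV[R]_d A <->
  forall x y (t : R), A x -> A y -> 0 <= t <= 1 -> A (t *: x + (1 - t) *: y).
Proof.
split=> [cA x y t Ax Ay /andP[t0 t1]|H x y l].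
  have := cA x y (Itv01 t0 t1); rewrite !inE => /(_ Ax Ay); exact.
rewrite !inE => Ax Ay; apply: (H x y l%:num) => //.
by rewrite ge0 le1.
Qed.

Context {J : finType}.
Variable p : J -> 'rV[R]_d.

Lemma sub_conv_hull : range p `<=` conv_hull (range p).
Proof. exact: sub_smallest. Qed.

Lemma convex_conv_hull A : @convex_set R 'rV[R]_d (conv_hull A).
Proof.
apply/convex_setP => x y t Ax Ay t01 B [cB AB].
by apply: (convex_setP B).1 => //; [apply: Ax|apply: Ay].
Qed.

Lemma conv_hull_comb x : conv_hull (range p) x ->
  exists l : J -> R, [/\ forall i, 0 <= l i, \sum_i l i = 1
    & x = \sum_i l i *: p i].
Proof.
pose B := [set x | exists l : J -> R, [/\ forall i, 0 <= l i, \sum_i l i = 1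
    & x = \sum_i l i *: p i]].
suff : conv_hull (range p) `<=` B by exact.
apply: smallest_sub; last first.
  move=> _ [i _ <-]; exists (fun j => (j == i)%:R); split=> [j||].
  - by rewrite ler0n.
  - by rewrite (bigD1 i) //= eqxx big1 ?addr0 // => j /negPf->.
  rewrite (bigD1 i) //= eqxx scale1r big1 ?addr0 // => j /negPf->.
  by rewrite scale0r.
apply/convex_setP => y z t [l [l0 l1 ->]] [m [m0 m1 ->]] /andP[t0 t1].
exists (fun i => t * l i + (1 - t) * m i); split=> [i||].
- by rewrite addr_ge0 // mulr_ge0 // subr_ge0.
- by rewrite big_split -!mulr_sumr l1 m1 /=; ring.
rewrite [RHS](eq_bigr (fun i => t *: (l i *: p i) + (1 - t) *: (m i *: p i))).
  by rewrite big_split !scaler_sumr.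
by move=> i _; rewrite scalerDl !scalerA.
Qed.

(** Sums of weights at most [1] are allowed because the origin belongs to
    [A]: it receives the missing weight. *)
Lemma conv_hull_subcomb (s : seq J) (l : J -> R) A : @convex_set R 'rV[R]_d A ->
  A 0 -> (forall i, A (p i)) -> (forall i, i \in s -> 0 <= l i) ->
  \sum_(i <- s) l i <= 1 -> A (\sum_(i <- s) l i *: p i).
Proof.
move=> cA A0 Ap; elim: s l => [|i s IH] l l0; first by rewrite !big_nil.
rewrite !big_cons => l1; have li0 : 0 <= l i by apply: l0; rewrite mem_head.
have ls0 j : j \in s -> 0 <= l j by move=> js; apply: l0; rewrite inE js orbT.
have sum0 : 0 <= \sum_(j <- s) l j by rewrite big_seq sumr_ge0.
have [li1|li1] := eqVneq (l i) 1.
  have s0 : \sum_(j <- s) l j = 0 by apply/eqP; rewrite eq_le sum0 andbT; lra.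
  rewrite li1 scale1r big_seq big1 ?addr0 // => j js.
  suff -> : l j = 0 by rewrite scale0r.
  apply/eqP; move/eqP: s0; rewrite big_seq psumr_eq0 // => /allP/(_ j js).
  by rewrite js.
have li1' : l i < 1 by rewrite lt_neqAle li1; lra.
have -> : \sum_(j <- s) l j *: p j =
    (1 - l i) *: \sum_(j <- s) (l j / (1 - l i)) *: p j.
  rewrite scaler_sumr; apply: eq_bigr => j _; rewrite scalerA mulrC divfK //.
  by rewrite subr_eq0 eq_sym.
apply: ((convex_setP A).1 cA) => //; last by rewrite li0 ltW.
apply: (IH (fun j => l j / (1 - l i))) => [j /ls0 j0|].
  by rewrite divr_ge0 // subr_ge0 ltW.
by rewrite -mulr_suml ler_pdivrMr ?subr_gt0 // mul1r; lra.
Qed.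

End hulls.

(** * Facets of a polytope with an interior origin *)

Section polar.
Context {R : realType} {d : nat} {I : finType}.
Variable p : I -> 'rV[R]_d.
Hypothesis p_spans : forall w, w != 0 -> exists i, 0 < dot (p i) w.
Implicit Types (u w x : 'rV[R]_d) (s : {set I}).

Definition in_polar u := forall i, dot (p i) u <= 1.

Definition tight u : {set I} := finset (fun i => dot (p i) u == 1).

(** The vertices of the polar, characterized by the linear algebra of their
    active constraints. *)
Definition facet_normal u :=
  in_polar u /\ forall w, (forall i, i \in tight u -> dot (p i) w = 0) -> w = 0.

Lemma tightE u i : (i \in tight u) = (dot (p i) u == 1).
Proof. by rewrite finset.inE. Qed.

(** Move from [u] in the direction [w] until some constraint becomes active;
    since the points span positively, this happens after a finite time. *)
Lemma polar_ray u w : in_polar u -> w != 0 -> exists t j,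
  [/\ 0 <= t, in_polar (u + t *: w), dot (p j) (u + t *: w) = 1
    & 0 < dot (p j) w].
Proof.
move=> uP w0; have [i0 wi0] := p_spans w0.
pose Q := [pred i | 0 < dot (p i) w].
pose r i := (1 - dot (p i) u) / dot (p i) w.
have [j jw jmin] := @arg_minP _ _ _ i0 Q r wi0.
exists (r j), j; split=> // [|i|].
- by rewrite divr_ge0 ?subr_ge0 // ltW.
- rewrite dotDr dotZr; have [iw|iw] := ltP 0 (dot (p i) w).
    have := jmin i iw; rewrite {2}/r ler_pdivlMr //.
    by rewrite lerBrDr addrC.
  apply: le_trans (uP i); rewrite gerDl mulr_ge0_le0 //.
  by rewrite divr_ge0 ?subr_ge0 // ltW.
by rewrite dotDr dotZr divfK ?gt_eqF // addrC subrK.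
Qed.

(** As long as a direction orthogonal to the active constraints is left,
    moving along it adds one more. *)
Lemma exists_facet_normal : exists u, facet_normal u.
Proof.
suff H : forall k u, in_polar u -> (#|I| - #|tight u| < k)%N ->
    exists u, facet_normal u.
  by apply: (H _ 0 _ (leqnn _)) => i; rewrite dot0r.
elim=> // k IH u uP uk.
have [uF|uF] := pselect (facet_normal u); first by exists u.
have [w [w0 uw]] : exists w, w != 0 /\ forall i, i \in tight u ->
  dot (p i) w = 0.
  apply: contrapT => nw; apply: uF; split=> // w uw; apply/eqP; apply: contrapT.
  by move=> /negP w0; apply: nw; exists w.
have [t [j [_ uwP jt jw]]] := polar_ray uP w0.
apply: (IH _ uwP); suff : (#|tight u| < #|tight (u + t *: w)|)%N.
  by have := max_card (tight (u + t *: w)); move: uk; lia.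
apply: proper_card; apply/properP; split.
  apply/fintype.subsetP => i iu; rewrite tightE dotDr dotZr uw // mulr0 addr0.
  by rewrite -tightE.
exists j; first by rewrite tightE jt.
by apply: contraTN jw => /uw->; rewrite ltxx.
Qed.

(** Relax the constraint [i] and follow the edge [- c i]. The constraint [j]
    met at its end is independent of [tight u :\ i], because [c i] vanishes
    on the latter and not on [p j]. *)
Lemma facet_normal_exchange u (c : I -> 'rV[R]_d) i : facet_normal u ->
  i \in tight u ->
  (forall k j, k \in tight u -> j \in tight u -> dot (p k) (c j) = (k == j)%:R)
    ->
  (forall x, x = \sum_(k in tight u) dot x (c k) *: p k) ->
  exists2 u', facet_normal u' & (tight u' != tight u)
    && (tight u :\ i \subset tight u')%SET.
Proof.
move=> [uP uS] iu cD cK; have w0 : - c i != 0.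
  rewrite oppr_eq0; apply: contra_eq_neq (cD i i iu iu) => ->.
  by rewrite dot0r eqxx eq_sym oner_eq0.
have [t [j [_ uwP jt jw]]] := polar_ray uP w0.
have ju : j \notin tight u.
  by apply: contraTN jw => ju; rewrite dotNr cD // oppr_gt0 -leNgt ler0n.
have sub : (tight u :\ i \subset tight (u + t *: - c i))%SET.
  apply/fintype.subsetP => k; rewrite finset.in_setD1 => /andP[ki ku].
  rewrite tightE dotDr dotZr dotNr cD // (negbTE ki) oppr0 mulr0 addr0.
  by rewrite -tightE.
exists (u + t *: - c i); last first.
  rewrite sub andbT; apply: contraNneq ju => <-; by rewrite tightE jt.
split=> // w Hw.
have kw k : k \in tight u -> k != i -> dot (p k) w = 0.
  by move=> ku ki; apply: Hw; apply: (fintype.subsetP sub);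
    rewrite finset.in_setD1 ki.
have iw : dot (p i) w = 0.
  have := Hw j; rewrite tightE jt eqxx => /(_ isT).
  rewrite {1}(cK (p j)) dot_suml (bigD1 i) //= big1 ?addr0 => [|k /andP[ku ki]].
    move: jw; rewrite dotZl dotNr oppr_gt0 => jw /eqP.
    by rewrite mulf_eq0 (lt_eqF jw) => /eqP.
  by rewrite dotZl kw // mulr0.
apply: uS => k ku; have [->//|ki] := eqVneq k i; exact: kw.
Qed.

Lemma tight_spans u : facet_normal u -> forall w, exists c : I -> R,
  (forall i, i \notin tight u -> c i = 0) /\ w = \sum_i c i *: p i.
Proof.
move=> [_ uS] w.
pose A := \matrix_(k < #|I|) if enum_val k \in tight u then p (enum_val k) else
  0.
have fA : row_full A.
  rewrite -col_leq_rank leqNgt; apply/negP => /exists_orthogonal[c c0 Ac].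
  move: c0; rewrite (uS c) ?eqxx // => i iu.
  by have := Ac (enum_rank i); rewrite rowK enum_rankK iu dotC.
have /submxP[D ->] := submx_full w fA.
exists (fun i => if i \in tight u then D 0 (enum_rank i) else 0); split.
  by move=> i /negbTE->.
rewrite mulmx_sum_row (reindex (@enum_rank I)) /=; last first.
  by exists enum_val => k _; rewrite ?enum_rankK ?enum_valK.
apply: eq_bigr => i _; rewrite rowK enum_rankK.
by case: ifP; rewrite ?scaler0 ?scale0r.
Qed.

End polar.

(** * Smooth Fano polytopes *)

(** The coordinates of the unit vectors form an integral inverse of the
    matrix of the basis; its columns are the dual basis. *)
Lemma Z_basis_dual (R : realType) d (b : 'I_d -> 'rV[R]_d) :
  (forall x : 'rV[R]_d, lattice x ->
     exists! c : {ffun 'I_d -> int}, x = \sum_i b i *~ c i) ->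
  exists c : 'I_d -> 'rV[R]_d, [/\ forall j, lattice (c j),
    forall i j, dot (b i) (c j) = (i == j)%:R
    & forall x, x = \sum_i dot x (c i) *: b i].
Proof.
move=> Hb; pose B := \matrix_i b i.
have eC (i : 'I_d) : exists c : 'rV[R]_d, lattice c /\ delta_mx 0 i = c *m B.
  have [|c [Hc _]] := Hb (delta_mx 0 i).
    by apply/mxOverP => k l; rewrite mxE rpred_nat.
  exists (\row_j (c j)%:~R); split; first by apply/mxOverP => k l; rewrite mxE.
  rewrite Hc mulmx_sum_row; apply: eq_bigr => j _.
  by rewrite mxE rowK scaler_int.
have [C HC] := boolp.choice eC.
pose M := \matrix_i C i.
have MB : M *m B = 1%:M.
  apply/row_matrixP => i; rewrite row_mul rowK -(HC i).2; apply/rowP => j.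
  by rewrite !mxE eqxx eq_sym.
have BM := mulmx1C MB.
exists (fun j => (col j M)^T); split=> [j|i j|x].
- apply/mxOverP => k l; rewrite !mxE; have /mxOverP := (HC l).1; exact.
- move/matrixP/(_ i j): BM; rewrite !mxE => <-; apply: eq_bigr => k _.
  by rewrite !mxE.
rewrite -{1}[x]mulmx1 -MB mulmxA mulmx_sum_row; apply: eq_bigr => i _.
rewrite rowK; congr (_ *: _); rewrite mxE; apply: eq_bigr => k _.
by rewrite !mxE.
Qed.

Section smooth_facets.
Context {R : realType} {d : nat} {I : finType}.
Variable p : I -> 'rV[R]_d.
Hypothesis d_gt0 : (0 < d)%N.
Implicit Types (u w x : 'rV[R]_d) (s : {set I}).

Local Notation P := (conv_hull (range p)).

Definition facet_at u : set 'rV[R]_d := P `&` [set x | dot u x = 1].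

Lemma polar_hull u x : in_polar p u -> P x -> dot x u <= 1.
Proof.
move=> uP /conv_hull_comb[l [l0 l1 ->]]; rewrite dot_suml -l1.
by apply: ler_sum => i _; rewrite dotZl ler_piMr.
Qed.

(** Since [dot u x = 1], a convex combination equal to [x] can only use
    points where [u] attains its bound [1]. *)
Lemma facet_at_comb u x : in_polar p u -> facet_at u x ->
  exists l : I -> R, [/\ forall i, 0 <= l i, forall i, i \notin tight p u ->
    l i = 0,
    \sum_i l i = 1 & x = \sum_i l i *: p i].
Proof.
move=> uP [/conv_hull_comb[l [l0 l1 xE]] /= xu]; exists l; split=> // i iu.
have H : \sum_i l i * (1 - dot (p i) u) = 0.
  rewrite (eq_bigr (fun i => l i - l i * dot (p i) u)); last by move=> j _;
    rewrite mulrBr mulr1.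
  rewrite sumrB l1 -[X in X - _]xu xE dotC dot_suml -sumrB big1 // => j _.
  by rewrite dotZl subrr.
move/eqP: H; rewrite psumr_eq0 => [/allP/(_ i (mem_index_enum _))|j _].
  by rewrite /= mulf_eq0 subr_eq0 (eq_sym 1) -tightE (negbTE iu) orbF => /eqP.
by rewrite mulr_ge0 // subr_ge0.
Qed.

Lemma tight_facet_at u i : i \in tight p u -> facet_at u (p i).
Proof.
rewrite tightE => /eqP iu; split; first by apply: sub_conv_hull; exists i.
by rewrite /= dotC.
Qed.

Lemma vertices_facet_at u v : in_polar p u -> vertices (facet_at u) v ->
  exists2 i, i \in tight p u & v = p i.
Proof.
move=> uP [a [c [ac vE]]].
have [vF vc] : facet_at u v /\ dot a v = c.
  by have : [set v] v by []; rewrite vE.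
have [l [l0 lu l1 vl]] := facet_at_comb uP vF.
have [i iu ic] : exists2 i, i \in tight p u & dot a (p i) = c.
  apply: contrapT => nc.
  have lt i : i \in tight p u -> dot a (p i) < c.
    move=> iu; rewrite lt_neqAle ac ?andbT; last exact: tight_facet_at.
    by apply/eqP => ic; apply: nc; exists i.
  have le i : l i * dot a (p i) <= l i * c.
    have [/lt/ltW iu|/lu->] := boolP (i \in tight p u); last by rewrite !mul0r.
    exact: ler_wpM2l.
  have [i il] : exists i, l i != 0.
    apply: contrapT => nl; have : \sum_i l i = 0.
      apply: big1 => i _; apply/eqP/negPn/negP => li; apply: nl; by exists i.
    by rewrite l1 => /eqP; rewrite oner_eq0.
  have iu : i \in tight p u by apply: contraNT il => /lu->.
  have : dot a v < c.
    rewrite dotC vl dot_suml -[ltRHS]mul1r -l1 mulr_suml.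
    rewrite !(bigD1 (P := xpredT) i) //=; apply: ltr_leD.
      by rewrite dotZl dotC ltr_pM2l ?lt // lt_neqAle eq_sym il l0.
    by apply: ler_sum => j _; rewrite dotZl dotC.
  by rewrite vc ltxx.
exists i => //; have : [set v] (p i) by rewrite vE; split=> //;
  exact: tight_facet_at.
by [].
Qed.

(** The linear form [g] attains its maximum over the facet only at [p m]. *)
Lemma exposed_vertex u g m : in_polar p u -> m \in tight p u ->
  (forall i, i \in tight p u -> p i != p m -> dot (p i) g < dot (p m) g) ->
  vertices (facet_at u) (p m).
Proof.
move=> uP mu gm; exists g, (dot g (p m)).
have le i : i \in tight p u -> dot (p i) g <= dot (p m) g.
  by move=> iu; have [->//|im] := eqVneq (p i) (p m); apply/ltW/gm.
split=> [x xF|].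
  have [l [l0 lu l1 ->]] := facet_at_comb uP xF.
  rewrite -/(dot g _) !(dotC g) dot_suml -[leRHS]mul1r -l1 mulr_suml.
  apply: ler_sum => i _; rewrite dotZl.
  have [/le iu|/lu->] := boolP (i \in tight p u); last by rewrite !mul0r.
  exact: ler_wpM2l.
apply/seteqP; split=> [_ ->|x [xF /= xg]].
  by split=> //; exact: tight_facet_at.
have [l [l0 lu l1 xl]] := facet_at_comb uP xF.
have H : \sum_i l i * (dot (p m) g - dot (p i) g) = 0.
  rewrite (eq_bigr (fun i => l i * dot (p m) g - l i * dot (p i) g));
    last first.
    by move=> j _; rewrite mulrBr.
  rewrite sumrB -mulr_suml l1 mul1r dotC -[X in X - _]xg -/(dot g x) xl dotC.
  by rewrite dot_suml -sumrB big1 // => j _; rewrite dotZl subrr.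
have lm i : p i != p m -> l i = 0.
  move=> im; have [iu|/lu//] := boolP (i \in tight p u).
  move/eqP: H; rewrite psumr_eq0 => [/allP/(_ i (mem_index_enum _))|j _].
    by rewrite /= mulf_eq0 subr_eq0 (gt_eqF (gm i iu im)) orbF => /eqP.
  have [ju|/lu->] := boolP (j \in tight p u); last by rewrite mul0r.
  by rewrite mulr_ge0 // subr_ge0 le.
rewrite xl /= (eq_bigr (fun i => l i *: p m)); last first.
  by move=> i _; have [->//|/lm->] := eqVneq (p i) (p m); rewrite !scale0r.
by rewrite -scaler_suml l1 scale1r.
Qed.

Lemma dim_kernel_dot u : u != 0 ->
  exists2 U : {vspace 'rV[R]_d}, (forall x, (x \in U) = (dot u x == 0))
    & \dim U = d.-1.
Proof.
move=> u0; have lin : linear (fun x : 'rV[R]_d => dot u x : R^o).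
  by move=> a x y; rewrite dotDr dotZr.
pose f' := GRing.isLinear.Build R 'rV[R]_d R^o *%R (fun x => dot u x : R^o) lin.
pose f : {linear 'rV[R]_d -> R^o} := HB.pack (fun x => dot u x : R^o) f'.
exists (lker (linfun f)); first by move=> x; rewrite memv_ker lfunE.
have := limg_ker_dim (linfun f) fullv; rewrite capfv dimvf.
have -> : \dim (linfun f @: fullv) = 1%N.
  apply/eqP; rewrite eqn_leq; apply/andP; split.
    by rewrite (leq_trans (dimvS (subvf _))) // dimvf.
  rewrite lt0n dimv_eq0; apply/eqP => im0.
  have : linfun f u \in (linfun f @: fullv)%VS by rewrite memv_img // memvf.
  rewrite im0 memv0 lfunE /= => /eqP uu.
  by have := dotvv_gt0 u0; rewrite [dot _ _]uu ltxx.
by rewrite dim_matrix mul1r addn1 => /(congr1 predn).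
Qed.

(** The least subspace that contains the differences is the kernel of [u]: a
    vector of the kernel is a combination of tight points with sum of
    coefficients zero, hence a combination of differences of tight points. *)
Lemma facet_facet_at u : facet_normal p u -> facet P (facet_at u).
Proof.
move=> uF; have [uP uS] := uF; split.
  exists u, 1; split=> // x Px; rewrite -/(dot u x) dotC; exact: polar_hull.
have [i0 iu0] : exists i, i \in tight p u.
  apply: contrapT => nu; have w0 : (const_mx 1 : 'rV[R]_d) = 0.
    by apply: uS => i iu; case: nu; exists i.
  have /eqP := congr1 (fun w : 'rV_d => w 0 (Ordinal d_gt0)) w0.
  by rewrite !mxE oner_eq0.
have iu1 : dot (p i0) u = 1 by apply/eqP; rewrite -tightE.
have u0 : u != 0.
  by apply: contra_eq_neq iu1 => ->; rewrite dot0r eq_sym oner_neq0.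
have [U UE dimU] := dim_kernel_dot u0.
exists (p i0), U; split=> //; first exact: tight_facet_at.
  by move=> x [_ /= xu]; rewrite UE dotBr -/(dot u x) in xu *;
    rewrite xu dotC iu1 subrr.
move=> W HW; apply/subvP => w; rewrite UE dotC => /eqP wu.
have [c [c0 wE]] := tight_spans uF w.
have -> : w = \sum_i c i *: (p i - p i0).
  rewrite (eq_bigr (fun i => c i *: p i - c i *: p i0)).
    rewrite sumrB -wE -scaler_suml (_ : \sum_i c i = 0) ?scale0r ?subr0 //.
    apply: (etrans _ wu); rewrite wE dot_suml; apply: eq_bigr => i _;
      rewrite dotZl.
    have [|/c0->] := boolP (i \in tight p u); last by rewrite mul0r.
    by rewrite tightE => /eqP->; rewrite mulr1.
  by move=> i _; rewrite scalerBr.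
apply: rpred_sum => i _; have [iu|/c0->] := boolP (i \in tight p u).
  by apply: memvZ; apply/HW/tight_facet_at.
by rewrite scale0r mem0v.
Qed.

Hypothesis p_inj : injective p.
Hypothesis p_int : forall i, lattice (p i).
Hypothesis smooth : forall F, facet P F -> Z_basis (vertices F).

(** The vertices of the facet form a basis [b] with an integral dual basis
    [c]. A tight point that is not one of the [b j] would have integral
    coordinates with sum [1], hence a negative one, say the [j]-th. A generic
    form close to [- c j] is maximal over the tight points at a single one,
    which is a vertex whose [j]-th coordinate is negative; but the
    coordinates of a vertex [b l] are [0] and [1]. *)
Lemma facet_normal_basis u : facet_normal p u -> exists c : I -> 'rV[R]_d,
  [/\ #|tight p u| = d,
    forall i j, i \in tight p u -> j \in tight p u ->
      dot (p i) (c j) = (i == j)%:R,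
    forall x, x = \sum_(i in tight p u) dot x (c i) *: p i
  & forall i x, i \in tight p u -> lattice x -> dot x (c i) \is a Num.int].
Proof.
move=> uF; have [uP _] := uF.
have [b [vb b_int b_basis]] := smooth (facet_facet_at uF).
have [c [c_int bc cK]] := Z_basis_dual b_basis.
have bk j : exists i, i \in tight p u /\ b j = p i.
  have : vertices (facet_at u) (b j) by rewrite vb; exists j.
  by move=> /(vertices_facet_at uP)[i iu ->]; exists i.
have [k Hk] := boolp.choice bk.
have bkE j : p (k j) = b j by have [] := Hk j.
have ku j : k j \in tight p u by have [] := Hk j.
have k_inj : injective k.
  move=> i j kij; apply/eqP; have := bc i j; rewrite -bkE kij bkE bc eqxx.
  by case: eqP => // _ /eqP; rewrite oner_eq0.
have tight_k i : i \in tight p u -> exists j, i = k j.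
  move=> iu; apply: contrapT => nk.
  have dot_int x j : lattice x -> dot x (c j) \is a Num.int.
    move=> /mxOverP xi; apply: rpred_sum => l _; rewrite rpredM //.
    by have /mxOverP := c_int j; apply.
  have sum1 : \sum_j dot (p i) (c j) = 1.
    move: (iu); rewrite tightE {1}(cK (p i)) dot_suml => /eqP <-.
    apply: eq_bigr => j _; rewrite dotZl -bkE.
    by have := ku j; rewrite tightE => /eqP->; rewrite mulr1.
  (* otherwise the coordinates are natural numbers with sum 1, and p i is one
     of the basis vectors *)
  have [j cj] : exists j, dot (p i) (c j) < 0.
    apply: contrapT => nc.
    have c0 j : 0 <= dot (p i) (c j).
      by rewrite leNgt; apply/negP => cj; apply: nc; exists j.
    have [j cj] : exists j, dot (p i) (c j) != 0.
      apply: contrapT => nz; have /eqP := sum1;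
        rewrite big1 ?(eq_sym 0) ?oner_eq0 //.
      by move=> j _; apply/eqP/negPn/negP => cj; apply: nz; exists j.
    have le1 : 1 <= dot (p i) (c j).
      have := dot_int _ j (p_int i); move/intrP => [m mE].
      rewrite mE -[1]/(1%:~R) ler_int; have := c0 j; have := cj.
      by rewrite mE ler0z intr_eq0; lia.
    have := sum1; rewrite (bigD1 j) //= => s1.
    have s0 : 0 <= \sum_(l < d | l != j) dot (p i) (c l) by apply: sumr_ge0.
    have cj1 : dot (p i) (c j) = 1 by lra.
    have /eqP : \sum_(l < d | l != j) dot (p i) (c l) = 0 by lra.
    rewrite psumr_eq0 // => /allP H0.
    apply: nk; exists j; apply: p_inj;
      rewrite bkE [LHS]cK (bigD1 j) //= cj1 scale1r.
    rewrite big1 ?addr0 // => l lj.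
    have := H0 l (mem_index_enum _); rewrite lj /= => /eqP->.
    by rewrite scale0r.
  (* a form that separates the points and is close to - c j *)
  pose L := [seq p e.1 - p e.2 | e <- enum [pred e : I * I | e.1 != e.2]].
  have inL a a' : a != a' -> p a - p a' \in L.
    by move=> aa; apply/mapP; exists (a, a') => //; rewrite mem_enum inE.
  have [|g Hg] := @exists_generic _ _ (- c j) L.
    apply/allP => w /mapP[[a a']]; rewrite mem_enum inE /= => aa ->.
    by rewrite subr_eq0 (inj_eq p_inj).
  have [m mu mmax'] :=
    @arg_maxP _ _ _ i (mem (tight p u)) (fun a => dot (p a) g) iu.
  have mmax a : a \in tight p u -> dot (p a) g <= dot (p m) g := mmax' a.
  have mv : vertices (facet_at u) (p m).
    apply: (exposed_vertex (g := g) uP mu) => a au am.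
    rewrite lt_neqAle mmax // andbT -subr_eq0 -dotBl dotC.
    have am' : a != m by apply: contraNneq am => ->.
    by have [] := Hg _ (inL a m am').
  have [l _ pm] : range b (p m) by rewrite -vb.
  have cm : 0 <= dot (p m) (c j) by rewrite -pm bc ler0n.
  have im : i != m.
    by apply: contraTneq cm => <-; rewrite -ltNge.
  have [_] := Hg _ (inL i m im); rewrite dotNl dotBr !(dotC (c j)) !(dotC g).
  rewrite oppr_gt0 subr_lt0 => /(_ (lt_le_trans cj cm)).
  by rewrite dotBl subr_gt0 ltNge mmax.
pose kinv i := odflt (Ordinal d_gt0) [pick j | k j == i].
have kK : cancel k kinv.
  by move=> j; rewrite /kinv; case: pickP => [l /eqP/k_inj//|/(_ j)];
    rewrite eqxx.
have tightK : tight p u = finset (fun i => i \in codom k).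
  apply/setP => i; rewrite [RHS]finset.inE;
    apply/idP/codomP => [/tight_k[j ->]|[j ->]].
    by exists j.
  exact: ku.
have card_tight : #|tight p u| = d.
  by rewrite tightK cardsE card_codom // card_ord.
exists (fun i => c (kinv i)); split=> //.
- move=> i j /tight_k[a ->] /tight_k[a' ->]; rewrite !kK bkE bc.
  by rewrite (inj_eq k_inj).
- move=> x; rewrite {1}(cK x) tightK (eq_bigl (mem (codom k))); last first.
    by move=> i; rewrite finset.inE.
  rewrite (reindex_onto k kinv) /=; last by move=> i /codomP[j ->]; rewrite kK.
  apply: eq_big => j; rewrite ?kK ?codom_f ?eqxx // => _.
  by rewrite bkE.
move=> i x _ /mxOverP xi; apply: rpred_sum => l _; rewrite rpredM //.
by have /mxOverP := c_int (kinv i); apply.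
Qed.

End smooth_facets.

(** The points are a finite set of lattice points that spans [P]. That [P] is
    the intersection of the half-spaces of its facets follows from
    [exists_cone]: a point [x] of this intersection lies in a cone over a
    facet [s] and has there nonnegative coordinates, whose sum [dot x (normal
    s)] is at most [1]. *)
Theorem smooth_Fano_facet_system (R : realType) (d : nat) (P : set 'rV[R]_d) :
  (0 < d)%N -> smooth_Fano P ->
  exists (I : finType) (X : facet_system R d I),
    [/\ injective (pt X), forall i, lattice (pt X i),
      forall s i x, s \in facets X -> i \in s -> lattice x ->
        coef X x s i \is a Num.int
    & P = facet_body X].
Proof.
move=> d0 [[S [/finite_fsetP[B SB] S_int PE]] P0 smooth].
pose p (i : B) := fsval i; have p_inj : injective p := val_inj.
have rp : S = range p.
  rewrite SB; apply/seteqP; split=> [x xB|_ [i _ <-]]; last exact: fsvalP.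
  by exists [` xB]%fset.
rewrite {}rp in S_int PE; rewrite {}PE in P0 smooth *.
have p_int i : lattice (p i) by apply: S_int; exists i.
(* otherwise P would lie in the half-space where w is nonpositive, and 0
   would not be interior *)
have p_spans w : w != 0 -> exists i, 0 < dot (p i) w.
  move=> w0; have [e e0 /conv_hull_comb[l [l0 _ El]]] := interior_ray w P0.
  apply: contrapT => ns.
  have : dot (0 + e *: w) w <= 0.
    rewrite El dot_suml; apply: sumr_le0 => i _; rewrite dotZl mulr_ge0_le0 //.
    by rewrite leNgt; apply/negP => iw; apply: ns; exists i.
  by rewrite add0r dotZl leNgt mulr_gt0 // dotvv_gt0.
pose F : {set {set B}} :=
  finset (fun s => `[< exists u, facet_normal p u /\ tight p u = s >]).
have FP s : reflect (exists u, facet_normal p u /\ tight p u = s) (s \in F).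
  by rewrite finset.inE; apply: asboolP.
pose data (s : {set B}) (uc : 'rV[R]_d * (B -> 'rV[R]_d)) :=
  [/\ facet_normal p uc.1, tight p uc.1 = s, #|s| = d,
    forall i j, i \in s -> j \in s -> dot (p i) (uc.2 j) = (i == j)%:R
  & (forall x, x = \sum_(i in s) dot x (uc.2 i) *: p i) /\
    forall i x, i \in s -> lattice x -> dot x (uc.2 i) \is a Num.int].
have ex_data s : exists uc, s \in F -> data s uc.
  have [/FP[u [uF us]]|sF] := boolP (s \in F); last by exists (0, fun=> 0).
  have [c [cd cD cK cI]] := facet_normal_basis d0 p_inj p_int smooth uF.
  by exists (u, c) => _; rewrite /data -us; split.
have [uc Huc] := boolp.choice ex_data.
have [] : exists X : facet_system R d B,
    [/\ pt X = p, facets X = F & covec X = fun s i => (uc s).2 i].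
  unshelve eexists (@FacetSystem R d B p F (fun s => (uc s).1)
    (fun s i => (uc s).2 i) _ _ _ _ _ _ _); last by [].
  - have [u uF] := exists_facet_normal p_spans.
    by exists (tight p u); apply/FP; exists u.
  - by move=> s /Huc[].
  - by move=> s i /Huc[[uP _] _ _ _ _]; apply: uP.
  - by move=> s i /Huc[_ us _ _ _]; rewrite -tightE us.
  - by move=> s i j /Huc[_ _ _ cD _]; apply: cD.
  - by move=> s x /Huc[_ _ _ _ [cK _]]; apply: cK.
  move=> s i /Huc[uF us _ cD [cK _]] si.
  rewrite -us in si cD cK *.
  have [u' u'F /andP[su ss]] := facet_normal_exchange p_spans uF si cD cK.
  by exists (tight p u'); [apply/FP; exists u' | rewrite su ss].
move=> X [ptE FE cE]; exists B, X; rewrite ptE FE.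
have X_int s i x : s \in F -> i \in s -> lattice x ->
  coef X x s i \is a Num.int.
  by move=> /Huc[_ _ _ _ [_ cI]]; rewrite /coef cE; apply: cI.
split=> //; apply/seteqP; split=> x Px.
  move=> s sF; have /conv_hull_comb[l [l0 l1 ->]] := Px.
  rewrite dot_suml -l1; apply: ler_sum => i _; rewrite dotZl ler_piMr //.
  by rewrite -ptE le_normal.
have [s sF cs] := exists_cone X x.
rewrite (covecK x sF) -big_enum /= ptE.
apply: conv_hull_subcomb.
- exact: convex_conv_hull.
- exact: interior_subset P0.
- by move=> i; apply: sub_conv_hull; exists i.
- by move=> i; rewrite mem_enum; apply: cs.
by rewrite big_enum /= -[X in X <= _](height_coef x sF) Px.
Qed.

(** A lattice point of the boundary lies in the cone over some facet with
    natural numbers as coordinates. Their sum is [1], for otherwise all the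
    inequalities would be strict; so one coordinate is [1] and the others are
    [0]. *)
Lemma facet_body_boundary (R : realType) (d : nat) (I : finType)
    (X : facet_system R d I) : (0 < d)%N ->
  (forall i, lattice (pt X i)) ->
  (forall s i x, s \in facets X -> i \in s -> lattice x ->
    coef X x s i \is a Num.int) ->
  boundary (facet_body X) `&` @lattice R d =
    [set pt X i | i in [set` vertex_set X]].
Proof.
move=> d0 p_int c_int; apply/seteqP; split=> [x [[xP xi] x_int]|_ [i /= iV <-]].
  have {}xP := halfspaces_closure xP.
  have [s sF c0] := exists_cone X x.
  have sum1 : \sum_(i in s) coef X x s i = 1.
    apply/eqP; rewrite -(height_coef x sF) eq_le xP //= leNgt;
      apply/negP => lt1.
    apply: xi; apply: halfspaces_interior => t tF; apply: le_lt_trans lt1.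
    by apply: (height_le_top sF tF (finset.sub0set t)) => i si _; apply: c0.
  have [i si ci] : exists2 i, i \in s & coef X x s i != 0.
    apply: contrapT => nz; have /eqP := sum1;
      rewrite big1 ?(eq_sym 0) ?oner_eq0 //.
    by move=> i si; apply/eqP/negPn/negP => ci; apply: nz; exists i.
  have ci1 : 1 <= coef X x s i.
    have /intrP[m mE] := c_int s i x sF si x_int.
    rewrite mE -[1]/(1%:~R) ler_int; have := c0 i si; have := ci.
    by rewrite mE ler0z intr_eq0; lia.
  have := sum1; rewrite (bigD1 i) //= => s1.
  have r0 : 0 <= \sum_(j in s | j != i) coef X x s j.
    by apply: sumr_ge0 => j /andP[/c0].
  have c1 : coef X x s i = 1 by lra.
  have /eqP : \sum_(j in s | j != i) coef X x s j = 0 by lra.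
  rewrite psumr_eq0 => [/allP H0|j /andP[/c0]//].
  exists i => /=; first by apply/vertex_setP; exists s.
  rewrite [RHS](covecK x sF) (bigD1 i) //= -/(coef X x s i) c1 scale1r.
  rewrite big1 ?addr0 // => j /andP[sj ji].
  have := H0 j (mem_index_enum _); rewrite sj ji /= /coef => /eqP->.
  by rewrite scale0r.
have /vertex_setP[s sF si] := iV; split; last exact: p_int.
split; first by apply: subset_closure => t tF; apply: le_normal.
move=> /(interior_ray (pt X i))[e e0 /(_ s sF)].
by rewrite dotDl dotZl normal_eq1 // mulr1 gerDl leNgt e0.
Qed.

Theorem corollary1p8 (R : realType) (d : nat) (hd : (0 < d)%N)
    (P : set 'rV[R]_d) (hP : smooth_Fano P) :
  let n : nat := #|` fset_set (boundary P `&` @lattice R d)| in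
  (((d%:R - 1) * n%:R - (d%:R + 1) * (d%:R - 2))%:E <= (d`!)%:R%:E * vol P)%E
  /\ ((d`!)%:R%:E * vol P <=
      ('C(n - (d + 1) %/ 2, n - d) + 'C(n - (d + 2) %/ 2, n - d))%N%:R%:E)%E.
Proof.
have [I [X [p_inj p_int c_int ->]]] := smooth_Fano_facet_system hd hP.
rewrite facet_body_boundary // vol_facet_body //.
have -> : #|` fset_set [set pt X i | i in [set` vertex_set X]]|
  = #|vertex_set X|.
  rewrite (_ : [set pt X i | i in _]
    = [set` [fset pt X i | i in vertex_set X]%fset]).
    by rewrite set_fsetK card_imfset //= -cardE.
  apply/seteqP; split=> [_ [i /= iV <-]|x /= /imfsetP[i /= iV ->]].
    by rewrite in_imfset.
  by exists i.
move=> n /=; split; last by rewrite lee_fin ler_nat; apply: facets_upper_bound.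
have nd : (d < n)%N := card_vertex_set X hd.
have [k dk] : exists k, d = k.+1 by exists d.-1; rewrite prednK.
have [m nm] : exists m, n = (m + d.+1)%N by exists (n - d.+1)%N; rewrite subnK.
have := facets_lower_bound X hd; rewrite -/n lee_fin -(ler_nat R) nm addnK.
move: #|facets X| => f; rewrite dk /=.
apply: le_trans; rewrite !natrD natrM -!natr1 le_eqVlt; apply/orP; left.
by apply/eqP; ring.
Qed.
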